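(* Let $\mathbb I=[t_0,t_f]\subset\mathbb R$ be a compact interval. Consider a pHDAE system on $\mathbb I$ of differentiation-index at most one (strangeness index $\mu=0$) with no trivial equations ($\nu=0$) whose coefficient $E(t)$ has constant rank. Assume that the system has been transformed, by pointwise invertible $U,V$ as described in the context, into a pHDAE of the block form $$\begin{bmatrix} E_{11} & 0 \\ 0 & 0 \end{bmatrix}\begin{bmatrix} \dot x_1 \\ \dot x_2 \end{bmatrix}=\left(\begin{bmatrix} L_{11} & L_{12} \\ L_{21} & L_{22} \end{bmatrix}\begin{bmatrix} Q_{11} & 0 \\ 0 & Q_{22} \end{bmatrix}-\begin{bmatrix} E_{11}K_{11} & E_{11}K_{12} \\ 0 & 0 \end{bmatrix}\right)\begin{bmatrix} x_1 \\ x_2 \end{bmatrix}+\begin{bmatrix} B_1-P_1 \\ B_2-P_2 \end{bmatrix}u,$$ $$y=\begin{bmatrix} (B_1+P_1)^T & (B_2+P_2)^T \end{bmatrix}\begin{bmatrix} Q_{11} & 0 \\ 0 & Q_{22} \end{bmatrix}\begin{bmatrix} x_1 \\ x_2 \end{bmatrix}+(S+N)u,$$ where $E_{11}$ is pointwise invertible, $$\begin{bmatrix} L_{11} & L_{12} \\ L_{21} & L_{22} \end{bmatrix}=\begin{bmatrix} J_{11} & J_{12} \\ J_{21} & J_{22} \end{bmatrix}-\begin{bmatrix} R_{11} & R_{12} \\ R_{12}^T & R_{22} \end{bmatrix},$$ $L_{22}$ and $Q_{22}$ are pointwise invertible (as is implied by the index assumption), and $$(J_{12}-R_{12})Q_{22}-E_{11}K_{12}=0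 .$$ Then for any input function $u$ and any initial value $x_1(t_0)=x_{1,0}$, the first component $x_1$ of the solution and the output $y$ of the block system are given by the reduced implicit system $$E_{11}\dot x_1=[(J_{11}-R_{11})Q_{11}-E_{11}K_{11}]x_1+(\hat B-\hat P)u,\quad x_1(t_0)=x_{1,0},$$ $$y=(\hat B+\hat P)^TQ_{11}x_1+(\hat S+\hat N)u,$$ which is a pHDAE system with Hamiltonian $\hat{\mathcal H}(x_1)=\frac12x_1^TQ_{11}^TE_{11}x_1=\mathcal H(x)$, where $\mathcal H$ is the Hamiltonian of the given system, and with coefficients $$\hat B=B_1-\tfrac12(J_{21}^T-R_{12})L_{22}^{-T}(B_2+P_2),$$ $$\hat P=P_1-\tfrac12(J_{21}^T-R_{12})L_{22}^{-T}(B_2+P_2),$$ $$\hat S=S-\tfrac12\left[(B_2+P_2)^TL_{22}^{-1}(B_2-P_2)+(B_2-P_2)^TL_{22}^{-T}(B_2+P_2)\right],$$ $$\hat N=N-\tfrac12\left[(B_2+P_2)^TL_{22}^{-1}(B_2-P_2)-(B_2-P_2)^TL_{22}^{-T}(B_2+P_2)\right].$$ Furthermore, $x_2$ is uniquely determined by the algebraic constraint $$L_{22}Q_{22}x_2=-L_{21}Q_{11}x_1-(B_2-P_2)u,$$ and the initial condition has to satisfy the consistency constraint $$L_{22}(t_0)Q_{22}(t_0)x_2(t_0)=-L_{21}(t_0)Q_{11}(t_0)x_1(t_0)-(B_2(t_0)-P_2(t_0))u(t_0).$$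
   Context: $C^j(\mathbb I,\mathcal X)$ denotes the $j$-times continuously differentiable functions from $\mathbb I$ to $\mathcal X$; the argument $t$ is suppressed; $M^{-T}=(M^{-1})^T$. Definition (pHDAE). A system $$E\dot x=[(J-R)Q-EK]x+(B-P)u,\qquad y=(B+P)^TQx+(S+N)u$$ with $E,Q\in C^1(\mathbb I,\mathbb R^{n,n})$, $J,R,K\in C^0(\mathbb I,\mathbb R^{n,n})$, $B,P\in C^0(\mathbb I,\mathbb R^{n,m})$, $S=S^T,\ N=-N^T\in C^0(\mathbb I,\mathbb R^{m,m})$ is called a port-Hamiltonian descriptor system (pHDAE) if: i) $Q^TE=E^TQ$ and $\frac{d}{dt}(Q^TE)=Q^T[EK-JQ]+[EK-JQ]^TQ$ for all $t\in\mathbb I$; ii) the Hamiltonian $\mathcal H(x)=\frac12x^TQ^TEx$ is bounded from below: there is $h_0\in\mathbb R$ with $\mathcal H(x(t))\ge h_0$ for all $t\in\mathbb I$ and all solutions $x$ of the system; iii) $W=\begin{bmatrix} Q^TRQ & Q^TP \\ P^TQ & S \end{bmatrix}$ satisfies $W(t)=W(t)^T\ge0$ for all $t\in\mathbb I$. Index assumption ($\mu=0$, $\nu=0$, for the state equation with $u=0$). Put $A=(J-R)Q-EK$. There are integers $a,d\ge 0$ with $a+d=n$ such that $\operatorname{rank}E(t)=d$ for all $t$, and there are continuous, pointwise full-column-rank matrix functions $Z_2$ (size $n\times a$) and $T_2$ (size $n\times d$) with $Z_2^TE=0$, $\operatorname{rank}Z_2^TA=a$, $Z_2^TAT_2=0$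 and $\operatorname{rank}(ET_2)=d$ on $\mathbb I$. If $a=0$, the second block row and column below are absent. Transformation. For pointwise invertible $U,V$, with $V$ differentiable, the pHDAE is transformed by replacing $(E,Q,J,R,B,P,K,x)$ by $(U^TEV,\ U^{-1}QV,\ U^TJU,\ U^TRU,\ U^TB,\ U^TP,\ V^{-1}KV+V^{-1}\dot V,\ V^{-1}x)$, leaving $S,N,u,y$ unchanged; this leaves the value of the Hamiltonian unchanged. The blocks $E_{11},Q_{ij},J_{ij},R_{ij},K_{ij},B_i,P_i$ in the claim are those of the transformed coefficients, partitioned conformably with $x=(x_1,x_2)$, $x_1(t)\in\mathbb R^d$, $x_2(t)\in\mathbb R^a$. The transformed block system is itself a pHDAE in the sense of the definition (in particular $E_{11},Q_{11}$ are $C^1$). A solution of the block system for an input $u\in C^0(\mathbb I,\mathbb R^m)$ is a pair $x_1\in C^1(\mathbb I,\mathbb R^d)$, $x_2\in C^0(\mathbb I,\mathbb R^a)$ satisfying the equations (only $\dot x_1$ occurs); condition ii) for the block system refers to these solutions. *)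

(* Defs.v *)
From HB Require Import structures.
From mathcomp Require Import all_boot all_order all_algebra.
From mathcomp Require Import all_classical all_reals all_analysis.

Set Implicit Arguments.
Unset Strict Implicit.
Unset Printing Implicit Defensive.

Import Order.TTheory GRing.Theory Num.Theory.
Import numFieldNormedType.Exports.

Local Open Scope classical_set_scope.
Local Open Scope ring_scope.

Section regularity.
Variables (R : realType) (I : set R) (p q : nat).
Implicit Type f : R -> 'M[R]_(p, q).

(* Functions are total on R, but only their values on I matter: limits are
   taken within I, so on an interval [t0, tf] with t0 < tf the derivatives at
   t0 and tf are the one-sided ones. *)
Definition diff_quotient f (t s : R) : 'M[R]_(p, q) :=
  (s - t)^-1 *: (f s - f t).

Definition deriv_on f (t : R) : 'M[R]_(p, q) :=
  lim (diff_quotient f t @ within I t^').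

Definition differentiable_on f : Prop :=
  forall t, I t -> cvg (diff_quotient f t @ within I t^').

Definition C0_on f : Prop := {within I, continuous f}.

Definition C1_on f : Prop := differentiable_on f /\ C0_on (deriv_on f).

End regularity.

Record coeffs (R : realType) (n m : nat) := Coeffs {
  cE : R -> 'M[R]_n;
  cQ : R -> 'M[R]_n;
  cJ : R -> 'M[R]_n;
  cR : R -> 'M[R]_n;
  cK : R -> 'M[R]_n;
  cB : R -> 'M[R]_(n, m);
  cP : R -> 'M[R]_(n, m);
  cS : R -> 'M[R]_m;
  cN : R -> 'M[R]_m
}.

Section pHDAE.
Variables (R : realType) (I : set R) (n m : nat) (c : coeffs R n m).

Definition sysmx (t : R) : 'M[R]_n :=
  (cJ c t - cR c t) *m cQ c t - cE c t *m cK c t.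

(* Pointwise state equation; dx stands for the value of the derivative of x. *)
Definition state_eq (t : R) (u : 'cV[R]_m) (x dx : 'cV[R]_n) : Prop :=
  cE c t *m dx = sysmx t *m x + (cB c t - cP c t) *m u.

Definition output (t : R) (u : 'cV[R]_m) (x : 'cV[R]_n) : 'cV[R]_m :=
  (cB c t + cP c t)^T *m cQ c t *m x + (cS c t + cN c t) *m u.

Definition hamiltonian (t : R) (x : 'cV[R]_n) : R :=
  2^-1 * (x^T *m (cQ c t)^T *m cE c t *m x) 0 0.

Definition solution (u : R -> 'cV[R]_m) (x : R -> 'cV[R]_n) : Prop :=
  C1_on I x /\
  forall t, I t -> state_eq t (u t) (x t) (deriv_on I x t).

Definition dissipation_mx (t : R) : 'M[R]_(n + m) :=
  block_mx ((cQ c t)^T *m cR c t *m cQ c t) ((cQ c t)^T *m cP c t)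
           ((cP c t)^T *m cQ c t)           (cS c t).

Definition symmetric_psd k (W : 'M[R]_k) : Prop :=
  W^T = W /\ forall v : 'cV[R]_k, 0 <= (v^T *m W *m v) 0 0.

Definition regular_coeffs : Prop :=
  (C1_on I (cE c) /\ C1_on I (cQ c)) /\
  (C0_on I (cJ c) /\ C0_on I (cR c) /\ C0_on I (cK c)) /\
  (C0_on I (cB c) /\ C0_on I (cP c)) /\
  (C0_on I (cS c) /\ C0_on I (cN c)) /\
  (forall t, I t -> (cS c t)^T = cS c t /\ (cN c t)^T = - cN c t).

Definition hamiltonian_structure : Prop :=
  forall t, I t ->
    let G := (cQ c t)^T *m (cE c t *m cK c t - cJ c t *m cQ c t) in
    (cQ c t)^T *m cE c t = (cE c t)^T *m cQ c t /\
    deriv_on I (fun s => (cQ c s)^T *m cE c s) t = G + G^T.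

(* Sol u x: "x is a solution for the input u". *)
Definition hamiltonian_bounded_below
    (Sol : (R -> 'cV[R]_m) -> (R -> 'cV[R]_n) -> Prop) : Prop :=
  exists h0 : R, forall u x, C0_on I u -> Sol u x ->
    forall t, I t -> h0 <= hamiltonian t (x t).

(* The solution concept used in the lower bound on the Hamiltonian is a
   parameter: systems in block form admit a weaker one, see block_solution. *)
Definition pHDAE_for
    (Sol : (R -> 'cV[R]_m) -> (R -> 'cV[R]_n) -> Prop) : Prop :=
  [/\ regular_coeffs,
      hamiltonian_structure,
      hamiltonian_bounded_below Sol &
      forall t, I t -> symmetric_psd (dissipation_mx t)].

Definition pHDAE : Prop := pHDAE_for solution.

(* Strangeness index mu = 0 and no trivial equations (nu = 0), for u = 0. *)
Definition index_assumption (a d : nat) : Prop :=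
  (a + d)%N = n /\
  (forall t, I t -> \rank (cE c t) = d) /\
  exists (Z2 : R -> 'M[R]_(n, a)) (T2 : R -> 'M[R]_(n, d)),
    (C0_on I Z2 /\ C0_on I T2) /\
    forall t, I t ->
      (\rank (Z2 t) = a /\ \rank (T2 t) = d) /\
      [/\ (Z2 t)^T *m cE c t = 0,
          \rank ((Z2 t)^T *m sysmx t) = a,
          (Z2 t)^T *m sysmx t *m T2 t = 0 &
          \rank (cE c t *m T2 t) = d].

End pHDAE.

Definition transform (R : realType) (I : set R) (n m : nat)
    (U V : R -> 'M[R]_n) (c : coeffs R n m) : coeffs R n m := {|
  cE := fun t => (U t)^T *m cE c t *m V t;
  cQ := fun t => invmx (U t) *m cQ c t *m V t;
  cJ := fun t => (U t)^T *m cJ c t *m U t;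
  cR := fun t => (U t)^T *m cR c t *m U t;
  cK := fun t => invmx (V t) *m cK c t *m V t
                 + invmx (V t) *m deriv_on I V t;
  cB := fun t => (U t)^T *m cB c t;
  cP := fun t => (U t)^T *m cP c t;
  cS := cS c;
  cN := cN c
|}.

Definition coeffs_eq_on (R : realType) (I : set R) (n m : nat)
    (c c' : coeffs R n m) : Prop :=
  forall t, I t ->
    (cE c t = cE c' t /\ cQ c t = cQ c' t) /\
    (cJ c t = cJ c' t /\ cR c t = cR c' t /\ cK c t = cK c' t) /\
    (cB c t = cB c' t /\ cP c t = cP c' t) /\
    (cS c t = cS c' t /\ cN c t = cN c' t).

Record block_coeffs (R : realType) (d a m : nat) := BlockCoeffs {
  E11 : R -> 'M[R]_d;
  Q11 : R -> 'M[R]_d;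
  Q22 : R -> 'M[R]_a;
  J11 : R -> 'M[R]_d;
  J12 : R -> 'M[R]_(d, a);
  J21 : R -> 'M[R]_(a, d);
  J22 : R -> 'M[R]_a;
  R11 : R -> 'M[R]_d;
  R12 : R -> 'M[R]_(d, a);
  R22 : R -> 'M[R]_a;
  K11 : R -> 'M[R]_d;
  K12 : R -> 'M[R]_(d, a);
  K21 : R -> 'M[R]_(a, d);
  K22 : R -> 'M[R]_a;
  B1 : R -> 'M[R]_(d, m);
  B2 : R -> 'M[R]_(a, m);
  P1 : R -> 'M[R]_(d, m);
  P2 : R -> 'M[R]_(a, m);
  Sb : R -> 'M[R]_m;
  Nb : R -> 'M[R]_m
}.

Section block_system.
Variables (R : realType) (I : set R) (d a m : nat) (b : block_coeffs R d a m).

Definition L21 (t : R) : 'M[R]_(a, d) := J21 b t - (R12 b t)^T.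
Definition L22 (t : R) : 'M[R]_a := J22 b t - R22 b t.

Definition assemble : coeffs R (d + a) m := {|
  cE := fun t => block_mx (E11 b t) 0 0 0;
  cQ := fun t => block_mx (Q11 b t) 0 0 (Q22 b t);
  cJ := fun t => block_mx (J11 b t) (J12 b t) (J21 b t) (J22 b t);
  cR := fun t => block_mx (R11 b t) (R12 b t) (R12 b t)^T (R22 b t);
  cK := fun t => block_mx (K11 b t) (K12 b t) (K21 b t) (K22 b t);
  cB := fun t => col_mx (B1 b t) (B2 b t);
  cP := fun t => col_mx (P1 b t) (P2 b t);
  cS := Sb b;
  cN := Nb b
|}.

(* x2 is only continuous; the second block column of E vanishes, so the 0 in
   the place of the derivative of x2 is immaterial. *)
Definition block_solution (u : R -> 'cV[R]_m)
    (x1 : R -> 'cV[R]_d) (x2 : R -> 'cV[R]_a) : Prop :=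
  [/\ C1_on I x1, C0_on I x2 &
      forall t, I t ->
        state_eq assemble t (u t) (col_mx (x1 t) (x2 t))
                                  (col_mx (deriv_on I x1 t) 0)].

Definition block_pHDAE : Prop :=
  pHDAE_for I assemble (fun u x =>
    block_solution u (fun t => usubmx (x t)) (fun t => dsubmx (x t))).

Definition algebraic_constraint (t : R) (u : 'cV[R]_m)
    (x1 : 'cV[R]_d) (x2 : 'cV[R]_a) : Prop :=
  L22 t *m Q22 b t *m x2
  = - (L21 t *m Q11 b t *m x1) - (B2 b t - P2 b t) *m u.

Definition hatB (t : R) : 'M[R]_(d, m) :=
  B1 b t - 2^-1 *: (((J21 b t)^T - R12 b t) *m (invmx (L22 t))^T
                     *m (B2 b t + P2 b t)).

Definition hatP (t : R) : 'M[R]_(d, m) :=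
  P1 b t - 2^-1 *: (((J21 b t)^T - R12 b t) *m (invmx (L22 t))^T
                     *m (B2 b t + P2 b t)).

Definition hatS (t : R) : 'M[R]_m :=
  Sb b t - 2^-1 *:
    ((B2 b t + P2 b t)^T *m invmx (L22 t) *m (B2 b t - P2 b t)
     + (B2 b t - P2 b t)^T *m (invmx (L22 t))^T *m (B2 b t + P2 b t)).

Definition hatN (t : R) : 'M[R]_m :=
  Nb b t - 2^-1 *:
    ((B2 b t + P2 b t)^T *m invmx (L22 t) *m (B2 b t - P2 b t)
     - (B2 b t - P2 b t)^T *m (invmx (L22 t))^T *m (B2 b t + P2 b t)).

Definition reduced : coeffs R d m := {|
  cE := E11 b;
  cQ := Q11 b;
  cJ := J11 b;
  cR := R11 b;
  cK := K11 b;
  cB := hatB;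
  cP := hatP;
  cS := hatS;
  cN := hatN
|}.

End block_system.

(* Main.v *)
(* The decoupling condition removes x2 from the first block row, so x1 solves a
   linear ODE with continuous coefficients (solved by Picard iteration in an
   exponentially weighted sup norm), and invertibility of L22 Q22, which follows
   from the index assumption, yields x2. Comparing the blocks of
   d/dt (Q^T E) = G + G^T shows that J22 is skew and that
   Q11^T J21^T = - Q11^T R12. With these two identities the reduced dissipation
   form at (x1, u) equals the original one at (x1, x2, u), x2 being given by the
   algebraic constraint, so it inherits nonnegativity. *)

Require Import Defs.
From HB Require Import structures.
From mathcomp Require Import all_boot all_order all_algebra.
From mathcomp Require Import all_classical all_reals all_analysis.
From mathcomp Require Import lra ring.

Set Implicit Arguments.
Unset Strict Implicit.
Unset Printing Implicit Defensive.

Import Order.TTheory GRing.Theory Num.Theory.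
Import numFieldNormedType.Exports.

Local Open Scope classical_set_scope.
Local Open Scope ring_scope.

(** * Calculus relative to a set *)

(** The hatted coefficients are forced by the elimination. Inserting [Q22 x2] from the constraint
    into the output produces one term in [x1] and one feedthrough term. The state equation must keep
    the input matrix [B1 - P1], so half of the [x1] term is charged equally to [hatB] and [hatP];
    the feedthrough is split into its symmetric and skew parts. The equality of the dissipation
    forms is then what the power balance predicts: along solutions d/dt H = u^T y - (x,u)^T W (x,u),
    and H, u, y agree for both systems. It is proved as a pointwise algebraic identity, without
    solutions. Since [Q11] may be singular, the relation between [J21] and [R12] is available only
    on vectors of the form [Q11 x1]. The lower bound on the Hamiltonian, in contrast, concerns
    solutions: each solution of the reduced system has to be lifted to one of the block system.
    Derivatives are one-sided at the endpoints and [d], [a], [m] may be zero, so the calculus is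
    done entry by entry with limits taken inside [I]. *)

Lemma cvg_near_eq (R : realType) (T : Type) (F : set_system T) (FF : Filter F)
    (f g : T -> R) (l l' : R) :
  {near F, f =1 g} -> l = l' -> f @ F --> l -> g @ F --> l'.
Proof. by move=> fg <-; apply: cvg_trans; exact: near_eq_cvg. Qed.

(** A neighbourhood of a matrix is given by one neighbourhood per entry, and a filter is closed
    under the finite intersection over all entries. Empty matrices are covered. *)
Lemma mx_cvgP (R : realType) (p q : nat) (T : Type) (F : set_system T)
    (FF : Filter F) (f : T -> 'M[R]_(p, q)) (M : 'M[R]_(p, q)) :
  f @ F --> M <-> forall i j, (fun x => f x i j) @ F --> M i j.
Proof.
split=> [fM i j A MA|fM A [P MP PA]].
  have /fM : nbhs M [set N : 'M[R]_(p, q) | A (N i j)].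
    (* The family of entry neighbourhoods is [A] at position [(i, j)] and the whole line
       elsewhere. *)
    exists (fun i' j' => [set x | (i' == i) ==> (j' == j) ==> `[< A x >]]).
      move=> i' j'; case: eqVneq => [->|_]; last exact: filterE.
      case: eqVneq => [->|_]; last exact: filterE.
      by apply: filterS MA => x Ax /=; apply/asboolP.
    by move=> N /(_ i j) /=; rewrite !eqxx /= => /asboolP.
  by [].
rewrite /fmap /=.
have H : forall ij : 'I_p * 'I_q, F [set x | P ij.1 ij.2 (f x ij.1 ij.2)].
  by move=> [i j]; apply: fM; exact: MP.
apply: (@filterS _ F _
    [set x | forall ij : 'I_p * 'I_q, P ij.1 ij.2 (f x ij.1 ij.2)]).
  by move=> x Px; apply: PA => i j; exact: (Px (i, j)).
by have := @filter_forall _ _ _ F FF H.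
Qed.

Section relative_calculus.
Context {R : realType} (I : set R).
Implicit Types f g : R -> R.

Lemma C0_onP p q (f : R -> 'M[R]_(p, q)) :
  C0_on I f <-> forall i j, {within I, continuous (fun t => f t i j)}.
Proof.
split=> [/subspace_continuousP cf i j|cf].
  by apply/subspace_continuousP => x Ix; have /mx_cvgP := cf x Ix; apply.
apply/subspace_continuousP => x Ix; apply/mx_cvgP => i j.
by have /subspace_continuousP := cf i j; apply.
Qed.

(** Relational form of the derivative within [I]. At an isolated point of [I] the filter is
    degenerate and every [l] qualifies; uniqueness is recovered below on nondegenerate segments. *)
Definition has_der f (t l : R) : Prop :=
  (fun s => (s - t)^-1 * (f s - f t)) @ within I t^' --> l.

Definition has_mxder p q (f : R -> 'M[R]_(p, q)) (t : R)
    (D : 'M[R]_(p, q)) : Prop :=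
  diff_quotient f t @ within I t^' --> D.

Lemma has_mxderP p q (f : R -> 'M[R]_(p, q)) t D :
  has_mxder f t D <-> forall i j, has_der (fun s => f s i j) t (D i j).
Proof.
have E i j : (fun s => diff_quotient f t s i j) =
             (fun s => (s - t)^-1 * (f s i j - f t i j)).
  by apply/funext => s; rewrite !mxE.
split=> [/mx_cvgP fD i j|fD]; first by have := fD i j; rewrite E.
by apply/mx_cvgP => i j; rewrite E; exact: fD.
Qed.

Lemma has_der_cvg f t l : has_der f t l -> f @ within I (nbhs t) --> f t.
Proof.
move=> fl.
have st : (fun s => s - t) @ within I t^' --> (0 : R).
  have tt : id @ within I t^' --> t.
    by move=> A At; apply: cvg_within; exact: nbhs_dnbhs.
  by apply: cvg_near_eq (cvgB tt (cvg_cst t)); [exact: nearW|rewrite subrr].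
have f0 : f @ within I t^' --> f t.
  (* Away from [t], [f s] is [s - t] times the difference quotient, plus [f t]; the point [t] itself
     is added back at the end. *)
  have H : (fun s => (s - t) * ((s - t)^-1 * (f s - f t)) + f t) @ within I t^'
           --> 0 * l + f t by exact: cvgD (cvgM st fl) (cvg_cst (f t)).
  apply: cvg_near_eq H; last by rewrite mul0r add0r.
  apply: (@nearW _ (nbhs t)) => s st0 _.
  by rewrite mulrA divff ?mul1r ?subrK // subr_eq0.
move=> A Aft; have H : nbhs t (fun s => s != t -> I s -> A (f s)) := f0 A Aft.
change (nbhs t (fun s => I s -> A (f s))).
apply: filterS H => s H Is.
by case: (eqVneq s t) => [->|/H]; [exact: nbhs_singleton|apply].
Qed.

Lemma has_derD f g t k l :
  has_der f t k -> has_der g t l -> has_der (fun s => f s + g s) t (k + l).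
Proof.
move=> fk gl.
have H : (fun s => (s - t)^-1 * (f s - f t) + (s - t)^-1 * (g s - g t))
    @ within I t^' --> k + l by exact: cvgD fk gl.
apply: cvg_near_eq H => //.
by apply: (@nearW _ (nbhs t)) => s _ _; rewrite -mulrDr opprD addrACA.
Qed.

Lemma has_derN f t k : has_der f t k -> has_der (fun s => - f s) t (- k).
Proof.
move=> fk.
have H : (fun s => - ((s - t)^-1 * (f s - f t))) @ within I t^' --> - k
  by exact: cvgN fk.
apply: cvg_near_eq H => //.
by apply: (@nearW _ (nbhs t)) => s _ _; ring.
Qed.

Lemma has_der_cst (c t : R) : has_der (fun=> c) t 0.
Proof.
rewrite /has_der (_ : (fun s => (s - t)^-1 * (c - c)) = fun=> 0).
  exact: cvg_cst.
by apply/funext => s; rewrite subrr mulr0.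
Qed.

Lemma has_derM f g t k l :
  has_der f t k -> has_der g t l ->
  has_der (fun s => f s * g s) t (k * g t + f t * l).
Proof.
move=> fk gl.
have gt : g @ within I t^' --> g t.
  move=> A Ag; have H : nbhs t (fun s => I s -> A (g s)) := has_der_cvg gl Ag.
  change (nbhs t (fun s => s != t -> I s -> A (g s))).
  by apply: filterS H => s H _.
have H : (fun s => (s - t)^-1 * (f s - f t) * g s + f t * ((s - t)^-1 * (g s - g t)))
    @ within I t^' --> k * g t + f t * l.
  by exact: cvgD (cvgM fk gt) (cvgM (cvg_cst (f t)) gl).
by apply: cvg_near_eq H => //; apply: (@nearW _ (nbhs t)) => s _ _; ring.
Qed.

Lemma has_der_sum (T : Type) (r : seq T) (F : T -> R -> R) t (k : T -> R) :
  (forall i, has_der (F i) t (k i)) ->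
  has_der (fun s => \sum_(i <- r) F i s) t (\sum_(i <- r) k i).
Proof.
move=> Fk; elim: r => [|i r IH].
  rewrite big_nil; under eq_fun do rewrite big_nil; exact: has_der_cst.
by rewrite big_cons; under eq_fun do rewrite big_cons; exact: has_derD.
Qed.

(** At an interior point the restriction to [I] is vacuous near [t], and the shift [s = h + t] gives
    the directional derivative along 1. This is the bridge to the mean value and integration
    theorems. *)
Lemma has_der_dnbhs f t l : nbhs t I ->
  has_der f t l <-> (fun h => h^-1 *: (f (h *: 1 + t) - f t)) @ 0^' --> l.
Proof.
move=> It.
have E (P : set R) : within I t^' P <-> (\forall h \near 0^', P (h + t)).
  have -> : (\forall h \near 0^', P (h + t)) =
      (\forall h \near 0, h != 0 -> P (h + t)) by [].
  have -> : within I t^' P = (\forall s \near t, s != t -> I s -> P s) by [].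
  rewrite (near_shift 0) subr0; split=> H.
    have It' : \forall h \near 0, I (h + t).
      by move: It; rewrite -[nbhs t I]/(\near t, I t) (near_shift 0) subr0.
    apply: filterS2 It' H => h /= Ih H h0; apply: H => //.
    by rewrite -subr_eq0 addrK.
  by apply: filterS H => h /= H h0 _; apply: H; rewrite -subr_eq0 addrK in h0.
have Q s : (s - t)^-1 * (f s - f t) =
    (s - t)^-1 *: (f ((s - t) *: 1 + t) - f t).
  by rewrite /GRing.scale /= mulr1 subrK.
split=> H A Al.
  have /E := H A Al; apply: filterS => h.
  by rewrite /preimage /= Q addrK.
have HA : \forall h \near 0^', A (h^-1 *: (f (h *: 1 + t) - f t)) := H A Al.
apply/E; apply: filterS HA => h.
by rewrite /preimage /= Q addrK.
Qed.

Lemma has_der_derive f t l : nbhs t I -> is_derive t 1 f l -> has_der f t l.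
Proof. by move=> It [df <-]; apply/has_der_dnbhs. Qed.

Lemma derive_has_der f t l : nbhs t I -> has_der f t l -> is_derive t 1 f l.
Proof.
move=> It /has_der_dnbhs => /(_ It) fl; split; first by apply/cvg_ex; exists l.
exact: cvg_lim fl.
Qed.

End relative_calculus.

Lemma has_der_subset (R : realType) (A B : set R) (f : R -> R) t l :
  A `<=` B -> has_der B f t l -> has_der A f t l.
Proof.
move=> AB H P Pl.
have {}H : \forall s \near t, s != t -> B s -> P ((s - t)^-1 * (f s - f t)).
  exact: H P Pl.
change (\forall s \near t, s != t -> A s -> P ((s - t)^-1 * (f s - f t))).
by apply: filterS H => s H st As; apply: H => //; exact: AB.
Qed.

(** * Algebra of continuous matrix functions, up to inversion *)

Section C0_on_algebra.
Context {R : realType} (I : set R).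

Lemma within_continuousM (f g : R -> R) :
  {within I, continuous f} -> {within I, continuous g} ->
  {within I, continuous (fun t => f t * g t)}.
Proof. by move=> cf cg t; apply: continuousM; [exact: cf|exact: cg]. Qed.

Lemma within_continuous_sum (T : Type) (r : seq T) (F : T -> R -> R) :
  (forall k, {within I, continuous (F k)}) ->
  {within I, continuous (fun t => \sum_(k <- r) F k t)}.
Proof.
move=> cF; elim: r => [|k r IH].
  by under eq_fun do rewrite big_nil; move=> t; exact: cst_continuous.
under eq_fun do rewrite big_cons.
by move=> t; apply: continuousD; [exact: cF|exact: IH].
Qed.

Lemma within_continuous_prod (T : Type) (r : seq T) (F : T -> R -> R) :
  (forall k, {within I, continuous (F k)}) ->
  {within I, continuous (fun t => \prod_(k <- r) F k t)}.
Proof.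
move=> cF; elim: r => [|k r IH].
  by under eq_fun do rewrite big_nil; move=> t; exact: cst_continuous.
under eq_fun do rewrite big_cons.
by move=> t; apply: continuousM; [exact: cF|exact: IH].
Qed.

Lemma C0_on_entry p q (f : R -> 'M[R]_(p, q)) (h : 'I_p -> 'I_q -> R -> R) :
  (forall t i j, f t i j = h i j t) ->
  (forall i j, {within I, continuous (h i j)}) -> C0_on I f.
Proof.
move=> fh ch; apply/C0_onP => i j.
by rewrite (_ : (fun t => _) = h i j); [exact: ch|apply/funext => t; exact: fh].
Qed.

Lemma eq_C0_on p q (f g : R -> 'M[R]_(p, q)) :
  (forall t, I t -> f t = g t) -> C0_on I f -> C0_on I g.
Proof.
by move=> fg; apply: subspace_eq_continuous => t; rewrite inE; exact: fg.
Qed.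

Lemma C0_onD p q (f g : R -> 'M[R]_(p, q)) :
  C0_on I f -> C0_on I g -> C0_on I (fun t => f t + g t).
Proof.
move=> /C0_onP cf /C0_onP cg; apply: C0_on_entry => [t i j|i j].
  by rewrite mxE.
by move=> t; apply: continuousD; [exact: cf|exact: cg].
Qed.

Lemma C0_onN p q (f : R -> 'M[R]_(p, q)) :
  C0_on I f -> C0_on I (fun t => - f t).
Proof.
move=> /C0_onP cf; apply: C0_on_entry => [t i j|i j]; first by rewrite mxE.
by move=> t; apply: continuousN; exact: cf.
Qed.

Lemma C0_onM p q r (f : R -> 'M[R]_(p, q)) (g : R -> 'M[R]_(q, r)) :
  C0_on I f -> C0_on I g -> C0_on I (fun t => f t *m g t).
Proof.
move=> /C0_onP cf /C0_onP cg; apply: C0_on_entry => [t i j|i j].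
  by rewrite mxE.
apply: within_continuous_sum => k t.
by apply: continuousM; [exact: cf|exact: cg].
Qed.

Lemma C0_onZ p q (c : R) (f : R -> 'M[R]_(p, q)) :
  C0_on I f -> C0_on I (fun t => c *: f t).
Proof.
move=> /C0_onP cf; apply: C0_on_entry => [t i j|i j]; first by rewrite mxE.
by move=> t; apply: continuousM; [exact: cst_continuous|exact: cf].
Qed.

Lemma C0_on_tr p q (f : R -> 'M[R]_(p, q)) :
  C0_on I f -> C0_on I (fun t => (f t)^T).
Proof.
by move=> /C0_onP cf; apply: C0_on_entry => [t i j|i j]; [rewrite mxE|exact: cf].
Qed.

Lemma within_continuous_det n (f : R -> 'M[R]_n) :
  C0_on I f -> {within I, continuous (fun t => \det (f t))}.
Proof.
move=> /C0_onP cf; rewrite /determinant.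
apply: within_continuous_sum => s.
apply: within_continuousM; first by move=> t; exact: cst_continuous.
by apply: within_continuous_prod => i; exact: cf.
Qed.

(** Cramer's rule: determinant and cofactors are polynomial in the entries. Outside [I] the matrix
    may be singular and [invmx] takes a default value, so the formula is used on [I] only. *)
Lemma C0_on_inv n (f : R -> 'M[R]_n) :
  (forall t, I t -> f t \in unitmx) ->
  C0_on I f -> C0_on I (fun t => invmx (f t)).
Proof.
move=> fU cf.
apply: (@eq_C0_on _ _ (fun t => (\det (f t))^-1 *: \adj (f t))).
  by move=> t It; rewrite /invmx fU.
have cdet := within_continuous_det cf.
apply: C0_on_entry => [t i j|i j]; first by rewrite !mxE.
apply/subspace_continuousP => t It; apply: cvgM.
  apply: cvgV; first by have := fU t It; rewrite unitmxE unitfE.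
  by have /subspace_continuousP := cdet; apply.
suff : {within I, continuous (fun t => cofactor (f t) j i)}.
  by move/subspace_continuousP; apply.
apply: within_continuousM; first by move=> s; exact: cst_continuous.
apply: within_continuous_det; move/C0_onP: cf => cf.
apply: (C0_on_entry (h := fun k l r => f r (lift j k) (lift i l))) => //.
by move=> r k l; rewrite !mxE.
Qed.

End C0_on_algebra.

(** * Derivatives, monotonicity and primitives on a compact segment *)

Section segment_calculus.
Context {R : realType} (t0 tf : R).
Hypothesis t0tf : t0 < tf.
Local Notation I := (`[t0, tf]%classic : set R).
Implicit Types f g : R -> R.

Lemma segmentP t : I t <-> t0 <= t <= tf.
Proof. by rewrite /= in_itv. Qed.

(** Since [t0 < tf], every point is approached from inside the segment: from the right if [t < tf],
    from the left at [tf]. This makes [deriv_on] a genuine, unique limit. *)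
Lemma within_dnbhs_segment_proper t : I t -> ProperFilter (within I t^').
Proof.
move=> /segmentP /andP[t0t ttf].
split; last exact: within_filter.
move=> H0; have {H0}H : \forall s \near t, s != t -> I s -> False := H0.
have [t1|] := ltP t tf.
  have H1 : \forall s \near t^'+, False.
    near=> s; have ts : t < s by near: s; exact: nbhs_right_gt.
    have stf : s < tf by near: s; exact: nbhs_right_lt.
    have K : s != t -> I s -> False by near: s; exact: cvg_within.
    apply: K; first by rewrite gt_eqF.
    by apply/segmentP; rewrite (ltW stf) (le_trans t0t (ltW ts)).
  by have [] := filter_ex H1.
move=> tft; have t0t' : t0 < t by apply: lt_le_trans tft.
have H1 : \forall s \near t^'-, False.
  near=> s; have ts : s < t by near: s; exact: nbhs_left_lt.
  have stf : t0 < s by near: s; exact: nbhs_left_gt.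
  have K : s != t -> I s -> False by near: s; exact: cvg_within.
  apply: K; first by rewrite lt_eqF.
  by apply/segmentP; rewrite (ltW stf) /=; lra.
by have [] := filter_ex H1.
Unshelve. all: by end_near. Qed.

Lemma deriv_onE p q (f : R -> 'M[R]_(p, q)) t D :
  I t -> has_mxder I f t D -> deriv_on I f t = D.
Proof.
move=> It fD; have PF := within_dnbhs_segment_proper It.
have : has_mxder I f t (deriv_on I f t) by apply: (cvgP D).
move/has_mxderP => fl; move/has_mxderP : fD => fD.
by apply/matrixP => i j; exact: (cvg_unique _ (fl i j) (fD i j)).
Qed.

Lemma within_continuousP (f : R -> R) :
  {within I, continuous f} <-> forall t, I t -> f @ within I (nbhs t) --> f t.
Proof. exact: subspace_continuousP. Qed.

Lemma has_der_ge0_le f (f' : R -> R) :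
  (forall t, I t -> has_der I f t (f' t)) -> (forall t, I t -> 0 <= f' t) ->
  forall t, I t -> f t0 <= f t.
Proof.
move=> df f'0 t It.
have II s : s \in `]t0, tf[%R -> I s /\ nbhs s I.
  move=> sI; have sI' : s \in `[t0, tf]%R by apply: subset_itv_oo_cc.
  split; first exact: sI'.
  apply: filterS (near_in_itvoo sI) => x; exact: subset_itv_oo_cc.
have der s : s \in `]t0, tf[%R -> is_derive s 1 f (f' s).
  by move=> /II[sI sN]; exact: (derive_has_der sN (df s sI)).
have cf : {within `[t0, tf], continuous f}.
  by apply/within_continuousP => s /df/has_der_cvg.
apply: (ger0_derive1_le_cc _ _ cf) => //.
- by move=> s /der[].
- move=> s sI; have [_] := der s sI.
  by rewrite derive1E => ->; apply/f'0/(II s sI).1.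
- by rewrite in_itv /= lexx ltW.
- by move: It => /segmentP /andP[].
Qed.

(** Differential substitute for bounding the norm of an integral by the integral of a bound: [g + f]
    and [g - f] both have nonnegative derivative. *)
Lemma has_der_norm_le f g (f' g' : R -> R) :
  (forall t, I t -> has_der I f t (f' t)) ->
  (forall t, I t -> has_der I g t (g' t)) ->
  (forall t, I t -> `|f' t| <= g' t) ->
  forall t, I t -> `|f t - f t0| <= g t - g t0.
Proof.
move=> df dg fg t It; rewrite ler_norml; apply/andP; split.
  have := @has_der_ge0_le (fun s => g s + f s) (fun s => g' s + f' s) _ _ t It.
  rewrite -subr_ge0 => H; rewrite -subr_ge0.
  have -> : f t - f t0 - - (g t - g t0) = g t + f t - (g t0 + f t0) by ring.
  apply: H => s Is; first exact: has_derD (dg s Is) (df s Is).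
  by have := fg s Is; rewrite ler_norml => /andP[]; lra.
have := @has_der_ge0_le (fun s => g s + - f s) (fun s => g' s + - f' s) _ _ t It.
rewrite -subr_ge0 => H; rewrite -subr_ge0.
have -> : g t - g t0 - (f t - f t0) = g t + - f t - (g t0 + - f t0) by ring.
apply: H => s Is; first exact: has_derD (dg s Is) (has_derN (df s Is)).
by have := fg s Is; rewrite ler_norml => /andP[]; lra.
Qed.

(** Retraction of the line onto the segment; composing with it extends a function continuous on [I]
    to one continuous everywhere. *)
Let clamp (x : R) : R := Num.max t0 (Num.min x tf).

Lemma primitive_exists f : {within I, continuous f} ->
  exists F : R -> R, forall t, I t -> has_der I F t (f t).
Proof.
move=> /within_continuousP cf.
have Iclamp x : I (clamp x).
  by apply/segmentP; rewrite /clamp le_max lexx ge_max ge_min lexx orbT (ltW t0tf).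
have clampE x : I x -> clamp x = x.
  by move=> /segmentP /andP[t0x xtf]; rewrite /clamp (min_idPl xtf) (max_idPr t0x).
have cclamp : continuous clamp.
  move=> x; have c0 : {for x, continuous (fun=> t0 : R)} by exact: cvg_cst.
  have c1 : {for x, continuous (id : R -> R)} by exact: cvg_id.
  have c2 : {for x, continuous (fun=> tf : R)} by exact: cvg_cst.
  exact: (continuous_max c0 (continuous_min c1 c2)).
have cg : continuous (f \o clamp).
  move=> x A Af.
  have H : \forall s \near clamp x, I s -> A (f s) := cf _ (Iclamp x) A Af.
  have {}H : \forall y \near x, I (clamp y) -> A (f (clamp y)) := cclamp x _ H.
  by apply: filterS H => y; apply.
(* Integration starts strictly left of the segment, so that [t0] too is an interior point for the
   fundamental theorem; the one-sided derivatives follow by restriction. *)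
pose a := t0 - 1.
pose F (x : R) : R := (\int[lebesgue_measure]_(s in `[a, x]) (f \o clamp) s)%R.
exists F => t It.
have at1 : a < t by move: It => /segmentP; rewrite /a; lra.
have tt1 : t < t + 1 by lra.
have iF : lebesgue_measure.-integrable `[a, t + 1] (EFin \o (f \o clamp)).
  apply: continuous_compact_integrable; first exact: segment_compact.
  exact: continuous_subspaceT.
have [dF FE] : derivable F t 1 /\ derive1 F t = (f \o clamp) t.
  by apply: (continuous_FTC1 tt1 iF) => //; exact: cg.
have HT : has_der setT F t (f t).
  apply: has_der_derive; first exact: filterT.
  by split=> //; rewrite -derive1E FE /= clampE.
by apply: has_der_subset HT.
Qed.

Lemma within_continuous_bounded f : {within I, continuous f} ->
  exists2 D, 0 <= D & forall t, I t -> `|f t| <= D.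
Proof.
move=> cf; have cN : {within I, continuous (fun t => `|f t|)}.
  by move=> x; apply: continuous_comp; [exact: cf|exact: norm_continuous].
have [c cI cmax] := EVT_max (ltW t0tf) cN.
by exists `|f c| => // t It; exact: cmax.
Qed.

End segment_calculus.

(** * Linear differential equations *)

Lemma half_expr_small (R : realType) (C e : R) : 0 < e ->
  exists k, C * 2^-1 ^+ k < e.
Proof.
move=> e0; have h1 : `|2^-1 : R| < 1 by rewrite ger0_norm; lra.
have H : (fun k => C * 2^-1 ^+ k) @ \oo --> C * 0.
  by apply: cvgM; [exact: cvg_cst|exact: cvg_expr].
rewrite mulr0 in H.
by have [k _ /(_ k (leqnn k))] := cvgr_lt _ H e e0; exists k.
Qed.

Lemma half_expr_bound_eq0 (R : realType) (a C : R) :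
  (forall k, `|a| <= C * 2^-1 ^+ k) -> a = 0.
Proof.
move=> aC; apply/eqP; case: (eqVneq a 0) => // a0.
have a1 : 0 < `|a| by rewrite normr_gt0.
by have [k] := half_expr_small C a1; rewrite ltNge aC.
Qed.

Lemma geometric_step_cvg (R : realType) (u : nat -> R) (C : R) :
  (forall k, `|u k.+1 - u k| <= C * 2^-1 ^+ k) ->
  forall k, `|limn u - u k| <= 2 * C * 2^-1 ^+ k.
Proof.
move=> uC.
have C0 : 0 <= C by have := uC 0%N; rewrite expr0 mulr1; apply: le_trans.
have p0 k : 0 < (2^-1 : R) ^+ k by apply: exprn_gt0; lra.
have tail k n : `|u (k + n)%N - u k| <= 2 * C * 2^-1 ^+ k - 2 * C * 2^-1 ^+ (k + n).
  elim: n => [|n IH]; first by rewrite addn0 !subrr normr0.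
  have := uC (k + n)%N; rewrite addnS exprS.
  have := ler_normD (u (k + n).+1 - u (k + n)%N) (u (k + n)%N - u k).
  by rewrite subrKA; move: IH; lra.
have tail' k n : (k <= n)%N -> `|u n - u k| <= 2 * C * 2^-1 ^+ k.
  move=> kn; have := tail k (n - k)%N; rewrite subnKC // => /le_trans; apply.
  by have := p0 n; rewrite lerBlDr lerDl => /ltW pn; rewrite mulr_ge0 // mulr_ge0.
have cu : cvgn u.
  apply: R_complete; apply: cauchy_exP => e e0.
  have [k ke] := half_expr_small (2 * C) e0.
  exists (u k); exists k => // n kn.
  by apply: le_lt_trans ke; rewrite distrC; exact: tail'.
move=> k; have H : (fun n => `|u n - u k|) @ \oo --> `|limn u - u k|.
  by apply: cvg_norm; apply: cvgB; [exact: cu|exact: cvg_cst].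
rewrite -(cvg_lim _ H) //; apply: limr_le.
  by apply/cvg_ex; exists `|limn u - u k|.
by exists k => // n kn; exact: tail'.
Qed.

Lemma uniform_limit_within_continuous (R : realType) (I : set R)
    (u : nat -> R -> R) (f : R -> R) (C : R) :
  (forall k, {within I, continuous (u k)}) ->
  (forall k t, I t -> `|f t - u k t| <= C * 2^-1 ^+ k) ->
  {within I, continuous f}.
Proof.
move=> cu fu; apply/subspace_continuousP => t It.
apply/cvgrPdist_lt => e e0.
have e3 : 0 < e / 3 by lra.
have [k ke] := half_expr_small C e3.
have /subspace_continuousP/(_ t It)/cvgrPdist_lt/(_ _ e3) H := cu k.
have {}H : \forall s \near t, I s -> `|u k t - u k s| < e / 3 := H.
change (\forall s \near t, I s -> `|f t - f s| < e).
apply: filterS H => s H Is.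
have := H Is; have := fu k t It; have := fu k s Is.
have -> : f t - f s = (f t - u k t) + (u k t - u k s) - (f s - u k s) by ring.
move: (ler_normB (f t - u k t + (u k t - u k s)) (f s - u k s)).
move: (ler_normD (f t - u k t) (u k t - u k s)).
lra.
Qed.

Section linear_ode.
Context {R : realType} (t0 tf : R) (d : nat).
Hypothesis t0tf : t0 < tf.
Local Notation I := (`[t0, tf]%classic : set R).
Variable M : R -> 'M[R]_d.
Hypothesis cM : C0_on I M.

Lemma C0_on_bounded p q (f : R -> 'M[R]_(p, q)) : C0_on I f ->
  exists2 L, 0 <= L & forall t i j, I t -> `|f t i j| <= L.
Proof.
move=> /C0_onP cf.
have /choice[D DP] : forall ij : 'I_p * 'I_q,
    exists D, 0 <= D /\ forall t, I t -> `|f t ij.1 ij.2| <= D.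
  move=> [i j]; have [D D0 fD] := within_continuous_bounded t0tf (cf i j).
  by exists D.
(* A sum of the entry bounds dominates each of them and is still defined when there are no
   entries. *)
exists (\sum_ij D ij); first by apply: sumr_ge0 => ij _; exact: (DP ij).1.
move=> t i j It; apply: le_trans ((DP (i, j)).2 t It) _.
rewrite (bigD1 (i, j)) //= lerDl; apply: sumr_ge0 => ij _; exact: (DP ij).1.
Qed.

Lemma has_mxder_C0_on p q (f D : R -> 'M[R]_(p, q)) :
  (forall t, I t -> has_mxder I f t (D t)) -> C0_on I f.
Proof.
move=> fD; apply/C0_onP => i j; apply/subspace_continuousP => t It.
by have /has_mxderP/(_ i j)/has_der_cvg := fD t It.
Qed.

Lemma has_mxderB p q (f g : R -> 'M[R]_(p, q)) t D D' :
  has_mxder I f t D -> has_mxder I g t D' ->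
  has_mxder I (fun s => f s - g s) t (D - D').
Proof.
move=> /has_mxderP fD /has_mxderP gD; apply/has_mxderP => i j.
rewrite !mxE (_ : (fun s => _) = fun s => f s i j + - g s i j).
  by apply: has_derD; [exact: fD|apply: has_derN; exact: gD].
by apply/funext => s; rewrite !mxE.
Qed.

(* In the norm weighted by exp (lam (t - t0)) with lam = 2 (d L + 1), where L
   bounds the entries of M, integration of M z halves the bound on z. *)
Lemma volterra_contraction : exists2 w : R -> R,
  (forall t, I t -> 1 <= w t <= w tf) &
  forall (y z : R -> 'cV[R]_d) (D : R), 0 <= D ->
    (forall t, I t -> has_mxder I y t (M t *m z t)) ->
    (forall i, y t0 i 0 = 0) ->
    (forall t i, I t -> `|z t i 0| <= D * w t) ->
    forall t i, I t -> `|y t i 0| <= D * 2^-1 * w t.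
Proof.
have [L L0 ML] := C0_on_bounded cM.
pose lam := 2 * (d%:R * L + 1).
have lam0 : 0 <= lam by rewrite mulr_ge0 // addr_ge0 // mulr_ge0.
pose w t := expR (lam * (t - t0)).
have w0 t : 0 < w t by exact: expR_gt0.
exists w => [t /segmentP /andP[t0t ttf]|y z D D0 dy y0 zD t i It].
  rewrite /w ler_expR ler_wpM2l ?lerB // andbT.
  by rewrite -expR0 ler_expR mulr_ge0 // subr_ge0.
(* [D / 2 * w] serves as comparison function: its derivative is [D (d L + 1) w], which dominates
   each entry of [M z]. *)
have dw s : I s -> has_der I (fun s => D * 2^-1 * w s) s (D * 2^-1 * (lam * w s)).
  move=> Is.
  have ws : has_der I w s (w s * lam).
    apply: (@has_der_subset _ _ setT) => //.
    apply: has_der_derive; first exact: filterT.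
    have dl : is_derive s (1 : R) (fun s => lam * (s - t0)) lam.
      rewrite [X in is_derive _ _ _ X](_ : _ = lam *: (1 + 0 : R)); last first.
        by rewrite addr0 /GRing.scale /= mulr1.
      exact: (is_deriveZ lam (is_deriveD (is_derive_id s (1 : R))
        (is_derive_cst (- t0) s (1 : R)))).
    exact: (is_derive1_comp (is_derive_expR _) dl).
  have := has_derM (has_der_cst I (D * 2^-1) s) ws.
  by rewrite mul0r add0r [w s * _]mulrC.
have dyi s : I s -> has_der I (fun s => y s i 0) s ((M s *m z s) i 0).
  by move=> Is; have /has_mxderP := dy s Is; apply.
have Mz s : I s -> `|(M s *m z s) i 0| <= D * 2^-1 * (lam * w s).
  move=> Is; rewrite mxE.
  have H : `|\sum_j M s i j * z s j 0| <= \sum_(j < d) L * (D * w s).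
    apply: le_trans (ler_norm_sum _ _ _) _; apply: ler_sum => j _.
    by rewrite normrM ler_pM //; [exact: ML|exact: zD].
  apply: le_trans H _; rewrite sumr_const card_ord -mulr_natl /lam.
  have := mulr_ge0 D0 (ltW (w0 s)); lra.
have := has_der_norm_le t0tf dyi dw Mz It.
rewrite y0 subr0 => /le_trans; apply.
by rewrite lerBlDr lerDl mulr_ge0 // ?mulr_ge0 // ltW.
Qed.

(** The difference of two solutions is its own image under integration against [M], so any bound on
    it can be halved indefinitely. *)
Lemma linear_ode_unique (g x y : R -> 'cV[R]_d) :
  (forall t, I t -> has_mxder I x t (M t *m x t + g t)) ->
  (forall t, I t -> has_mxder I y t (M t *m y t + g t)) ->
  x t0 = y t0 -> forall t, I t -> x t = y t.
Proof.
move=> dx dy xy0.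
have [w w1 contr] := volterra_contraction.
pose z t := x t - y t.
have dz t : I t -> has_mxder I z t (M t *m z t).
  move=> It; have := has_mxderB (dx t It) (dy t It).
  by rewrite opprD addrACA subrr addr0 -mulmxBr.
have z0 i : z t0 i 0 = 0 by rewrite /z xy0 subrr mxE.
have [D D0 zD] := C0_on_bounded (has_mxder_C0_on dz).
have zDk k t i : I t -> `|z t i 0| <= D * 2^-1 ^+ k * w t.
  elim: k t i => [|k IH] t i It.
    rewrite expr0 mulr1; apply: le_trans (zD t i 0 It) _.
    by rewrite ler_peMr //; have /andP[] := w1 t It.
  rewrite exprSr mulrA; apply: (contr z z) => //.
  by rewrite mulr_ge0 // exprn_ge0.
move=> t It; apply/eqP; rewrite -subr_eq0 -[x t - y t]/(z t).
apply/eqP/matrixP => i j.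
rewrite ord1 [RHS]mxE; apply: (@half_expr_bound_eq0 _ _ (D * w t)) => k.
by have := zDk k t i It; rewrite mulrAC.
Qed.

Lemma mx_primitive_exists p q (f : R -> 'M[R]_(p, q)) x0 : C0_on I f ->
  exists2 F, forall t, I t -> has_mxder I F t (f t) & F t0 = x0.
Proof.
move=> /C0_onP cf.
have /choice[F FP] : forall ij : 'I_p * 'I_q,
    exists F : R -> R, forall t, I t -> has_der I F t (f t ij.1 ij.2).
  by move=> [i j]; exact: primitive_exists.
exists (fun t => \matrix_(i, j) (x0 i j + (F (i, j) t - F (i, j) t0))).
  move=> t It; apply/has_mxderP => i j.
  rewrite (_ : (fun s => _) = fun s => (x0 i j - F (i, j) t0) + F (i, j) s).
    rewrite -[f t i j]add0r.
    by apply: has_derD; [exact: has_der_cst|exact: (FP (i, j))].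
  by apply/funext => s; rewrite mxE; ring.
by apply/matrixP => i j; rewrite mxE subrr addr0.
Qed.

Lemma linear_ode_exists (g : R -> 'cV[R]_d) (x0 : 'cV[R]_d) : C0_on I g ->
  exists2 x : R -> 'cV[R]_d,
    forall t, I t -> has_mxder I x t (M t *m x t + g t) & x t0 = x0.
Proof.
move=> cg.
(* [T] is the Picard operator. Choice needs it on all functions; a discontinuous [z] gets the dummy
   value [z]. *)
have /choice[T TP] : forall z : R -> 'cV[R]_d, exists y : R -> 'cV[R]_d,
    C0_on I z -> (forall t, I t -> has_mxder I y t (M t *m z t + g t)) /\ y t0 = x0.
  move=> z; have [cz|ncz] := pselect (C0_on I z); last by exists z.
  have [y dy y0] := mx_primitive_exists x0 (C0_onD (C0_onM cM cz) cg).
  by exists y.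
have [w w1 contr] := volterra_contraction.
have w0 t : I t -> 0 <= w t by move=> /w1 /andP[/(le_trans ler01)].
have TB z y D : C0_on I z -> C0_on I y -> 0 <= D ->
    (forall t i, I t -> `|(z t - y t) i 0| <= D * w t) ->
    forall t i, I t -> `|(T z t - T y t) i 0| <= D * 2^-1 * w t.
  move=> cz cy D0 zyD.
  have [dz z0] := TP z cz; have [dy y0] := TP y cy.
  apply: (contr (fun t => T z t - T y t) (fun t => z t - y t)) => //.
    move=> t It; have := has_mxderB (dz t It) (dy t It).
    by rewrite opprD addrACA subrr addr0 -mulmxBr.
  by move=> i; rewrite z0 y0 subrr mxE.
pose X k := iter k T (fun=> x0).
have cX k : C0_on I (X k).
  elim: k => [|k IH]; first by apply/C0_onP => i j t; exact: cst_continuous.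
  exact: has_mxder_C0_on (TP _ IH).1.
have [D D0 XD] : exists2 D, 0 <= D &
    forall t i j, I t -> `|(X 1%N t - X 0%N t) i j| <= D.
  exact: C0_on_bounded (C0_onD (cX 1%N) (C0_onN (cX 0%N))).
have Xk k t i : I t -> `|(X k.+1 t - X k t) i 0| <= D * 2^-1 ^+ k * w t.
  elim: k t i => [|k IH] t i It.
    rewrite expr0 mulr1; apply: le_trans (XD t i 0 It) _.
    by rewrite ler_peMr //; have /andP[] := w1 t It.
  rewrite exprSr mulrA; apply: (TB (X k.+1) (X k)) => //.
  by rewrite mulr_ge0 // exprn_ge0.
pose x t : 'cV[R]_d := \col_i limn (fun k => X k t i 0).
have xX k t i : I t -> `|(x t - X k t) i 0| <= 2 * D * 2^-1 ^+ k * w t.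
  move=> It; rewrite !mxE.
  have := @geometric_step_cvg _ (fun k => X k t i 0) (D * w t).
  move=> /(_ _ k) H; apply: le_trans (H _) _; last by rewrite mulrA mulrAC.
  by move=> {H}k; have := Xk k t i It; rewrite !mxE mulrAC.
have cx : C0_on I x.
  apply/C0_onP => i j; rewrite ord1.
  apply: (@uniform_limit_within_continuous _ _ (fun k t => X k t i 0) _
    (2 * D * w tf)).
    by move=> k; have /C0_onP := cX k; apply.
  move=> k t It; have := xX k t i It; rewrite !mxE => /le_trans; apply.
  rewrite [leRHS]mulrAC ler_wpM2l ?mulr_ge0 ?exprn_ge0 //.
  by have /andP[] := w1 t It.
have [dTx Tx0] := TP x cx.
(* Both [T x] and [x] lie within [D 2^-k w] of the iterate [X k.+1], for every [k]. *)
have Txx t : I t -> T x t = x t.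
  move=> It; apply/eqP; rewrite -subr_eq0; apply/eqP/matrixP => i j.
  rewrite ord1 [RHS]mxE; apply: (@half_expr_bound_eq0 _ _ (2 * D * w t)) => k.
  have p0 : 0 <= D * 2^-1 ^+ k * w t.
    by rewrite mulr_ge0 ?w0 // mulr_ge0 // exprn_ge0.
  have H1 : `|(T x t - X k.+1 t) i 0| <= 2 * D * 2^-1 ^+ k * 2^-1 * w t.
    apply: (TB x (X k)) => //; first by rewrite !mulr_ge0 // exprn_ge0.
    by move=> s i' Is; exact: xX.
  have H2 := xX k.+1 t i It.
  move: H1 H2; rewrite !mxE exprSr => H1 H2.
  have := ler_normB (T x t i 0 - X k.+1 t i 0) (x t i 0 - X k.+1 t i 0).
  rewrite mxE opprB addrA subrK; move: H1 H2; lra.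
(* [x] is known only as a uniform limit, whereas the derivative of [T x] is given by
   construction. *)
exists (T x) => // t It.
by rewrite Txx //; exact: dTx.
Qed.

End linear_ode.

(** * Regularity of blocks and products of matrix functions *)

Section matrix_regularity.
Context {R : realType} (t0 tf : R).
Hypothesis t0tf : t0 < tf.
Local Notation I := (`[t0, tf]%classic : set R).

(** Blocks are obtained from a matrix by maps on row and column indices, so one statement per
    regularity notion handles all of them. *)
Lemma C0_on_reindex p q p' q' (f : R -> 'M[R]_(p, q)) (g : R -> 'M[R]_(p', q'))
    (h : 'I_p' -> 'I_p) (k : 'I_q' -> 'I_q) :
  (forall t i j, g t i j = f t (h i) (k j)) -> C0_on I f -> C0_on I g.
Proof.
by move=> gf /C0_onP cf; apply: (C0_on_entry gf) => i j; exact: cf.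
Qed.

Lemma has_mxder_reindex p q p' q' (f : R -> 'M[R]_(p, q)) (g : R -> 'M[R]_(p', q'))
    (h : 'I_p' -> 'I_p) (k : 'I_q' -> 'I_q)
    t (D : 'M[R]_(p, q)) (D' : 'M[R]_(p', q')) :
  (forall t i j, g t i j = f t (h i) (k j)) ->
  (forall i j, D' i j = D (h i) (k j)) ->
  has_mxder I f t D -> has_mxder I g t D'.
Proof.
move=> gf D'D /has_mxderP fD; apply/has_mxderP => i j.
rewrite D'D (_ : (fun s => _) = fun s => f s (h i) (k j)); first exact: fD.
by apply/funext => s; rewrite gf.
Qed.

Lemma C1_on_reindex p q p' q' (f : R -> 'M[R]_(p, q)) (g : R -> 'M[R]_(p', q'))
    (h : 'I_p' -> 'I_p) (k : 'I_q' -> 'I_q) :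
  (forall t i j, g t i j = f t (h i) (k j)) -> C1_on I f -> C1_on I g.
Proof.
move=> gf [df cf].
have dg t : I t -> has_mxder I g t (mxsub h k (deriv_on I f t)).
  by move=> It; apply: has_mxder_reindex gf _ (df t It) => i j; rewrite mxE.
split; first by move=> t It; apply: cvgP (dg t It).
apply: (@eq_C0_on _ _ _ _ (fun t => mxsub h k (deriv_on I f t))).
  by move=> t It; rewrite (deriv_onE t0tf It (dg t It)).
by apply: C0_on_reindex cf => t i j; rewrite mxE.
Qed.

Lemma C1_on_C0_on p q (f : R -> 'M[R]_(p, q)) : C1_on I f -> C0_on I f.
Proof. by case=> df _; apply: has_mxder_C0_on => t; exact: df. Qed.

Lemma has_mxderM p q r (f : R -> 'M[R]_(p, q)) (g : R -> 'M[R]_(q, r)) t D D' :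
  has_mxder I f t D -> has_mxder I g t D' ->
  has_mxder I (fun s => f s *m g s) t (D *m g t + f t *m D').
Proof.
move=> /has_mxderP fD /has_mxderP gD; apply/has_mxderP => i j.
rewrite (_ : (fun s => _) = fun s => \sum_k f s i k * g s k j); last first.
  by apply/funext => s; rewrite mxE.
rewrite !mxE -big_split /=; apply: has_der_sum => k.
by apply: has_derM.
Qed.

Lemma C1_onP p q (f D : R -> 'M[R]_(p, q)) : C0_on I D ->
  (C1_on I f /\ forall t, I t -> deriv_on I f t = D t) <->
  forall t, I t -> has_mxder I f t (D t).
Proof.
move=> cD; split=> [[[df _] fD] t It|fD].
  by rewrite -fD //; exact: df.
have fE t : I t -> deriv_on I f t = D t.
  by move=> It; apply: deriv_onE => //; exact: fD.
split=> //; split; first by move=> t It; apply: cvgP (fD t It).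
by apply: (@eq_C0_on _ _ _ _ D) => // t It; rewrite fE.
Qed.

End matrix_regularity.

(** * Bilinear forms of matrices *)

Section bilinear_form.
Context {R : comRingType}.

(** Working with scalar values lets a term be replaced by its transpose, and turns matrix identities
    into linear arithmetic. *)
Definition bil p q (x : 'cV[R]_p) (M : 'M[R]_(p, q)) (y : 'cV[R]_q) : R :=
  (x^T *m M *m y) 0 0.

Lemma bil_tr p q (x : 'cV[R]_p) (M : 'M[R]_(p, q)) y : bil y M^T x = bil x M y.
Proof.
rewrite /bil -[x in LHS]trmxK (_ : _ *m _ = (x^T *m M *m y)^T) ?mxE //.
by rewrite !trmx_mul mulmxA.
Qed.

Lemma bil_mull p q r (A : 'M[R]_(p, r)) x (M : 'M[R]_(p, q)) y :
  bil (A *m x) M y = bil x (A^T *m M) y.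
Proof. by rewrite /bil trmx_mul !mulmxA. Qed.

Lemma bil_mulr p q r (A : 'M[R]_(q, r)) x (M : 'M[R]_(p, q)) y :
  bil x M (A *m y) = bil x (M *m A) y.
Proof. by rewrite /bil !mulmxA. Qed.

Lemma bilD p q x (M N : 'M[R]_(p, q)) y : bil x (M + N) y = bil x M y + bil x N y.
Proof. by rewrite /bil mulmxDr mulmxDl mxE. Qed.

Lemma bilZ p q c x (M : 'M[R]_(p, q)) y : bil x (c *: M) y = c * bil x M y.
Proof. by rewrite /bil -scalemxAr -scalemxAl mxE. Qed.

Lemma bilN p q x (M : 'M[R]_(p, q)) y : bil x (- M) y = - bil x M y.
Proof. by rewrite -scaleN1r bilZ mulN1r. Qed.

Lemma bilDr p q x (M : 'M[R]_(p, q)) y z : bil x M (y + z) = bil x M y + bil x M z.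
Proof. by rewrite /bil mulmxDr mxE. Qed.

Lemma bilNr p q x (M : 'M[R]_(p, q)) y : bil x M (- y) = - bil x M y.
Proof. by rewrite /bil mulmxN mxE. Qed.

Lemma bilDl p q x z (M : 'M[R]_(p, q)) y : bil (x + z) M y = bil x M y + bil z M y.
Proof. by rewrite /bil linearD /= !mulmxDl mxE. Qed.

Lemma bilNl p q x (M : 'M[R]_(p, q)) y : bil (- x) M y = - bil x M y.
Proof. by rewrite /bil linearN /= !mulNmx mxE. Qed.

Lemma bil_col p q r x y (A : 'M[R]_(p, r)) (B : 'M[R]_(q, r)) z :
  bil (col_mx x y) (col_mx A B) z = bil x A z + bil y B z.
Proof. by rewrite /bil tr_col_mx mul_row_col mulmxDl mxE. Qed.

Lemma bil_block p q r s x y (A : 'M[R]_(p, r)) (B : 'M[R]_(p, s)) (C : 'M[R]_(q, r))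
    (D : 'M[R]_(q, s)) x' y' :
  bil (col_mx x y) (block_mx A B C D) (col_mx x' y') =
  bil x A x' + bil x B y' + bil y C x' + bil y D y'.
Proof.
have addE (X Y : 'M[R]_1) : (X + Y) 0 0 = X 0 0 + Y 0 0 by rewrite mxE.
rewrite /bil tr_col_mx mul_row_block mul_row_col !mulmxDl !addE.
ring.
Qed.

End bilinear_form.

(* The kernel condition forces Z^T = (0, Zd), and eliminating T1 from
   Z^T A T = 0 writes Z^T A as Zd A22 times a matrix, so Zd A22 has rank a. *)
Lemma index_drsubmx_unit (F : fieldType) (d a : nat) (E : 'M[F]_d)
    (Z : 'M[F]_(d + a, a)) (T : 'M[F]_(d + a, d)) (A : 'M[F]_(d + a)) :
  E \in unitmx ->
  Z^T *m (block_mx E 0 0 0 : 'M[F]_(d + a)) = 0 ->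
  \rank (Z^T *m A) = a -> Z^T *m A *m T = 0 ->
  \rank ((block_mx E 0 0 0 : 'M[F]_(d + a)) *m T) = d ->
  drsubmx A \in unitmx.
Proof.
move=> EU ZE rZA ZAT rET.
rewrite -[Z^T]hsubmxK -[A]submxK -[T]vsubmxK in ZE rZA ZAT rET.
move: (lsubmx Z^T) (rsubmx Z^T) ZE rZA ZAT => Zu Zd ZE rZA ZAT.
move: (usubmx T) (dsubmx T) ZAT rET => T1 T2 ZAT rET.
have Zu0 : Zu = 0.
  move: ZE; rewrite mul_row_block !mulmx0 addr0 -[RHS]row_mx0 => /eq_row_mx[ZE _].
  by rewrite -(mulmxK EU Zu) ZE mul0mx.
rewrite Zu0 mul_row_block !mul0mx !add0r in rZA ZAT.
have T1U : T1 \in unitmx.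
  move: rET; rewrite mul_block_col !mul0mx !addr0 rank_col_mx0 => rET.
  have : E *m T1 \in unitmx by rewrite -row_free_unit /row_free rET.
  by rewrite unitmx_mul => /andP[].
move: ZAT; rewrite mul_row_col => /eqP; rewrite addr_eq0 => /eqP ZAT.
have Z21 : Zd *m dlsubmx A = Zd *m drsubmx A *m (- T2 *m invmx T1).
  by rewrite -(mulmxK T1U (Zd *m dlsubmx A)) ZAT !mulNmx mulmxN mulmxA.
have ZA : row_mx (Zd *m dlsubmx A) (Zd *m drsubmx A) =
    Zd *m drsubmx A *m row_mx (- T2 *m invmx T1) 1%:M.
  by rewrite mul_mx_row mulmx1 Z21.
have : Zd *m drsubmx A \in unitmx.
  rewrite -row_full_unit /row_full eqn_leq rank_leq_col /=.
  by rewrite -{1}rZA ZA mxrankM_maxl.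
by rewrite unitmx_mul => /andP[].
Qed.

(** * The block system *)

Section block_system_facts.
Context {R : realType} {d a m : nat}.
Variable b : block_coeffs R d a m.

Lemma assemble_QTE t : (cQ (assemble b) t)^T *m cE (assemble b) t =
  block_mx ((Q11 b t)^T *m E11 b t) 0 0 0.
Proof.
by rewrite /= tr_block_mx mulmx_block !trmx0 !mul0mx !mulmx0 !addr0.
Qed.

Lemma assemble_structure t :
  let G := (cQ (assemble b) t)^T *m
    (cE (assemble b) t *m cK (assemble b) t
     - cJ (assemble b) t *m cQ (assemble b) t) in
  G = block_mx
    ((Q11 b t)^T *m (E11 b t *m K11 b t - J11 b t *m Q11 b t))
    ((Q11 b t)^T *m (E11 b t *m K12 b t - J12 b t *m Q22 b t))
    (- ((Q22 b t)^T *m J21 b t *m Q11 b t))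
    (- ((Q22 b t)^T *m J22 b t *m Q22 b t)).
Proof.
rewrite /= tr_block_mx !mulmx_block opp_block_mx add_block_mx mulmx_block.
by rewrite !trmx0 !mul0mx !mulmx0 !addr0 !add0r !mulmxN !mulmxA.
Qed.

(** [hatB] and [hatP] carry the same correction, hence [hatB - hatP = B1 - P1]: the first block row
    already is the reduced equation, the second is the constraint. *)
Lemma state_eq_assemble t u x1 x2 dx1 :
  (J12 b t - R12 b t) *m Q22 b t - E11 b t *m K12 b t = 0 ->
  state_eq (assemble b) t u (col_mx x1 x2) (col_mx dx1 0) <->
  state_eq (reduced b) t u x1 dx1 /\ algebraic_constraint b t u x1 x2.
Proof.
move=> dec; rewrite /state_eq /algebraic_constraint /sysmx /=.
rewrite !opp_block_mx !opp_col_mx !add_block_mx !add_col_mx !mulmx_block.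
rewrite !opp_block_mx !add_block_mx !mul_block_col !mul_col_mx !add_col_mx.
rewrite !mul0mx !mulmx0 !addr0 !add0r !oppr0 !addr0 dec mul0mx addr0.
rewrite -/(L21 b t) -/(L22 b t) -[hatB b t - hatP b t]/(_) /hatB /hatP.
rewrite opprB addrA subrK.
split=> [/eq_col_mx[-> /esym/eqP]|[-> H]].
  by rewrite -addrA addrCA addr_eq0 opprD => /eqP ->.
by rewrite -addrA addrCA H -opprD addNr.
Qed.

(** Here the corrections become visible: the two halves in [hatB + hatP] add up to the transpose of
    [Bp^T Li L21], and in [hatS + hatN] the symmetric and skew parts recombine to [Bp^T Li Bm]. *)
Lemma output_reduced t u x1 x2 :
  L22 b t \in unitmx ->
  algebraic_constraint b t u x1 x2 ->
  output (assemble b) t u (col_mx x1 x2) = output (reduced b) t u x1.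
Proof.
move=> L22U; rewrite /algebraic_constraint => alg.
have {}alg : Q22 b t *m x2 =
    invmx (L22 b t) *m (- (L21 b t *m Q11 b t *m x1) - (B2 b t - P2 b t) *m u).
  by rewrite -alg -[L22 b t *m _ *m _]mulmxA mulKmx.
rewrite /output /= add_col_mx tr_col_mx mul_row_block !mulmx0 addr0 add0r.
rewrite mul_row_col -[_ *m Q22 b t *m x2]mulmxA alg.
set Bp := B2 b t + P2 b t; set Bm := B2 b t - P2 b t; set Li := invmx (L22 b t).
have -> : (hatB b t + hatP b t)^T =
    (B1 b t + P1 b t)^T - Bp^T *m Li *m L21 b t.
  have -> : Bp^T *m Li *m L21 b t = (((J21 b t)^T - R12 b t) *m Li^T *m Bp)^T.
    rewrite !trmx_mul trmxK mulmxA; congr (_ *m _).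
    by rewrite [RHS]linearB /= trmxK.
  rewrite /hatB /hatP -/Bp -/Li; move: (_ *m Bp) => X.
  by apply/matrixP => i j; rewrite !mxE; field.
have -> : hatS b t + hatN b t = Sb b t + Nb b t - Bp^T *m Li *m Bm.
  rewrite /hatS /hatN -/Bp -/Bm -/Li.
  move: (Bp^T *m Li *m Bm) (Bm^T *m _ *m _) => X Y.
  by apply/matrixP => i j; rewrite !mxE; field.
move: Bp Bm Li (L21 b t) (B1 b t + P1 b t)^T (Sb b t + Nb b t) {alg}.
move=> Bp Bm Li L Bs SN.
rewrite !mulmxA mulmxBr mulmxN !mulmxBl !mulmxA.
move: (_ *m x1) (_ *m x1) (_ *m u) (_ *m u) => X1 X2 X3 X4.
by apply/matrixP => i j; rewrite !mxE; ring.
Qed.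

Lemma hamiltonian_reduced t x1 x2 :
  hamiltonian (reduced b) t x1 = hamiltonian (assemble b) t (col_mx x1 x2).
Proof.
rewrite /hamiltonian -!(mulmxA _ (cQ _ _)^T) assemble_QTE /=.
rewrite tr_col_mx mul_row_block mul_row_col !mulmx0 !addr0 mul0mx addr0.
by rewrite !mulmxA.
Qed.

End block_system_facts.

Lemma hamiltonian_transform (R : realType) (I : set R) (n m : nat)
    (c : coeffs R n m) (U V : R -> 'M[R]_n) t x :
  U t \in unitmx ->
  hamiltonian (transform I U V c) t x = hamiltonian c t (V t *m x).
Proof.
move=> Ut; rewrite /hamiltonian /=; congr (_ * _ 0 0).
by rewrite !trmx_mul !mulmxA trmx_inv mulmxKV ?unitmx_tr.
Qed.

Lemma has_mxder_block0 (R : realType) (I : set R) p q p' q'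
    (f : R -> 'M[R]_(p, q)) t (D : 'M[R]_(p, q)) :
  has_mxder I f t D ->
  has_mxder I (fun s => block_mx (f s) 0 0 0 : 'M[R]_(p + p', q + q')) t
    (block_mx D 0 0 0).
Proof.
move=> /has_mxderP fD; apply/has_mxderP => i j.
rewrite -(splitK i) -(splitK j).
case: (fintype.split i) => i'; case: (fintype.split j) => j' /=.
- rewrite block_mxEul (_ : (fun s => _) = fun s => f s i' j'); first exact: fD.
  by apply/funext => s; rewrite block_mxEul.
- rewrite block_mxEur mxE (_ : (fun s => _) = fun=> 0); first exact: has_der_cst.
  by apply/funext => s; rewrite block_mxEur mxE.
- rewrite block_mxEdl mxE (_ : (fun s => _) = fun=> 0); first exact: has_der_cst.
  by apply/funext => s; rewrite block_mxEdl mxE.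
- rewrite block_mxEdr mxE (_ : (fun s => _) = fun=> 0); first exact: has_der_cst.
  by apply/funext => s; rewrite block_mxEdr mxE.
Qed.

(** * Regularity and structural identities of the blocks *)

Section block_structure.
Context {R : realType} (t0 tf : R) {d a m : nat}.
Hypothesis t0tf : t0 < tf.
Local Notation I := (`[t0, tf]%classic : set R).
Variable b : block_coeffs R d a m.
Hypothesis regb : regular_coeffs I (assemble b).
Hypothesis strb : hamiltonian_structure I (assemble b).

Lemma C1_on_E11 : C1_on I (E11 b).
Proof.
apply: (C1_on_reindex t0tf (h := lshift a) (k := lshift a)) regb.1.1 => t i j /=.
by rewrite block_mxEul.
Qed.

Lemma C1_on_Q11 : C1_on I (Q11 b).
Proof.
apply: (C1_on_reindex t0tf (h := lshift a) (k := lshift a)) regb.1.2 => t i j /=.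
by rewrite block_mxEul.
Qed.

Lemma C0_on_Q22 : C0_on I (Q22 b).
Proof.
apply: (C0_on_reindex (h := @rshift d a) (k := @rshift d a)) (C1_on_C0_on regb.1.2).
by move=> t i j /=; rewrite block_mxEdr.
Qed.

Lemma C0_on_J : [/\ C0_on I (J11 b), C0_on I (J21 b) & C0_on I (J22 b)].
Proof.
have [_ [[cJ _] _]] := regb; split.
- by apply: (C0_on_reindex (h := @lshift d a) (k := @lshift d a)) cJ => t i j;
     rewrite block_mxEul.
- by apply: (C0_on_reindex (h := @rshift d a) (k := @lshift d a)) cJ => t i j;
     rewrite block_mxEdl.
- by apply: (C0_on_reindex (h := @rshift d a) (k := @rshift d a)) cJ => t i j;
     rewrite block_mxEdr.
Qed.

Lemma C0_on_R : [/\ C0_on I (R11 b), C0_on I (R12 b) & C0_on I (R22 b)].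
Proof.
have [_ [[_ [cR _]] _]] := regb; split.
- by apply: (C0_on_reindex (h := @lshift d a) (k := @lshift d a)) cR => t i j;
     rewrite block_mxEul.
- by apply: (C0_on_reindex (h := @lshift d a) (k := @rshift d a)) cR => t i j;
     rewrite block_mxEur.
- by apply: (C0_on_reindex (h := @rshift d a) (k := @rshift d a)) cR => t i j;
     rewrite block_mxEdr.
Qed.

Lemma C0_on_K11 : C0_on I (K11 b).
Proof.
have [_ [[_ [_ cK]] _]] := regb.
by apply: (C0_on_reindex (h := @lshift d a) (k := @lshift d a)) cK => t i j;
   rewrite block_mxEul.
Qed.

Lemma C0_on_BP :
  [/\ C0_on I (B1 b), C0_on I (B2 b), C0_on I (P1 b) & C0_on I (P2 b)].
Proof.
have [_ [_ [[cB cP] _]]] := regb; split.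
- by apply: (C0_on_reindex (h := @lshift d a) (k := id)) cB => t i j;
     rewrite col_mxEu.
- by apply: (C0_on_reindex (h := @rshift d a) (k := id)) cB => t i j;
     rewrite col_mxEd.
- by apply: (C0_on_reindex (h := @lshift d a) (k := id)) cP => t i j;
     rewrite col_mxEu.
- by apply: (C0_on_reindex (h := @rshift d a) (k := id)) cP => t i j;
     rewrite col_mxEd.
Qed.

Lemma block_structureP t : I t ->
  [/\ (Q11 b t)^T *m E11 b t = (E11 b t)^T *m Q11 b t,
      let G := (Q11 b t)^T *m (E11 b t *m K11 b t - J11 b t *m Q11 b t) in
      deriv_on I (fun s => (Q11 b s)^T *m E11 b s) t = G + G^T,
      (Q11 b t)^T *m (E11 b t *m K12 b t - J12 b t *m Q22 b t)
        = (Q11 b t)^T *m (J21 b t)^T *m Q22 b t &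
      (Q22 b t)^T *m ((J22 b t)^T + J22 b t) *m Q22 b t = 0].
Proof.
move=> It; have [sym der] := strb It.
have symT : (cE (assemble b) t)^T *m cQ (assemble b) t =
    ((cQ (assemble b) t)^T *m cE (assemble b) t)^T by rewrite trmx_mul trmxK.
rewrite symT assemble_QTE tr_block_mx !trmx0 in sym.
have [symE _ _ _] := eq_block_mx sym.
have [[dE _] [dQ _]] := (C1_on_E11, C1_on_Q11).
have dQT : has_mxder I (fun s => (Q11 b s)^T) t (deriv_on I (Q11 b) t)^T.
  have /has_mxderP H : has_mxder I (Q11 b) t (deriv_on I (Q11 b) t) by exact: dQ.
  apply/has_mxderP => i j.
  rewrite mxE (_ : (fun s => _) = fun s => Q11 b s j i); first exact: H.
  by apply/funext => s; rewrite mxE.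
have dQE := has_mxderM dQT (dE t It).
(* Only the existence of this derivative matters; its value is read off from the structural
   identity. *)
move: (_ + _) dQE => D dQE.
have dB : has_mxder I (fun s => (cQ (assemble b) s)^T *m cE (assemble b) s) t
    (block_mx D 0 0 0).
  rewrite (_ : (fun s => _) = fun s => block_mx ((Q11 b s)^T *m E11 b s) 0 0 0).
    exact: has_mxder_block0.
  by apply/funext => s; rewrite assemble_QTE.
rewrite (deriv_onE t0tf It dB) assemble_structure tr_block_mx add_block_mx in der.
have [derul derur _ derdr] := eq_block_mx der.
split.
- by rewrite symE trmx_mul trmxK.
- by rewrite (deriv_onE t0tf It dQE).
- move: derur => /eqP; rewrite eq_sym addr_eq0 => /eqP ->.
  by rewrite linearN /= opprK !trmx_mul trmxK mulmxA.
- move: derdr; rewrite linearN /= !trmx_mul trmxK -opprD => /eqP.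
  rewrite eq_sym oppr_eq0 => /eqP <-.
  by rewrite mulmxDr mulmxDl addrC !mulmxA.
Qed.

End block_structure.

(* With x2 given by the algebraic constraint, skewness of J22 lets the
   quadratic term in w = Q22 x2 be eliminated through L22 w. *)
Lemma reduced_dissipation (R : realFieldType) (d a m : nat)
    (Q11 R11 : 'M[R]_d) (Q22 J22 R22 : 'M[R]_a) (J21 : 'M[R]_(a, d))
    (R12 : 'M[R]_(d, a)) (B2 P2 : 'M[R]_(a, m)) (P1 : 'M[R]_(d, m)) (S : 'M[R]_m)
    (x1 : 'cV[R]_d) (x2 : 'cV[R]_a) (u : 'cV[R]_m) :
  let L22 := J22 - R22 in let L21 := J21 - R12^T in
  let Bp := B2 + P2 in let Bm := B2 - P2 in let Li := invmx L22 in
  let Y := (J21^T - R12) *m Li^T *m Bp in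
  J22^T = - J22 -> Q11^T *m J21^T = - (Q11^T *m R12) -> L22 \in unitmx ->
  L22 *m Q22 *m x2 = - (L21 *m Q11 *m x1) - Bm *m u ->
  let hatP := P1 - 2^-1 *: Y in
  let hatS := S - 2^-1 *: (Bp^T *m Li *m Bm + Bm^T *m Li^T *m Bp) in
  let Q := block_mx Q11 0 0 Q22 in
  let P := col_mx P1 P2 in
  let z := col_mx x1 x2 in
  bil (col_mx x1 u)
    (block_mx (Q11^T *m R11 *m Q11) (Q11^T *m hatP) (hatP^T *m Q11) hatS)
    (col_mx x1 u) =
  bil (col_mx z u)
    (block_mx (Q^T *m block_mx R11 R12 R12^T R22 *m Q) (Q^T *m P) (P^T *m Q) S)
    (col_mx z u).
Proof.
move=> L22 L21 Bp Bm Li Y J22N QJ L22U alg hatP hatS Q P z.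
pose q := Q11 *m x1; pose w := Q22 *m x2.
have hw : L22 *m w = - (L21 *m q) - Bm *m u by rewrite /w /q !mulmxA.
have Qz : Q *m z = col_mx q w by rewrite mul_block_col !mul0mx addr0 add0r.
(* The hypothesis on [Q11] allows trading [J21^T] for [- R12] next to [q = Q11 x1], with no need to
   cancel [Q11]. *)
have qJ k (X : 'M[R]_(a, k)) (y : 'cV[R]_k) :
    bil q (J21^T *m X) y = - bil q (R12 *m X) y.
  by rewrite /q !bil_mull !mulmxA QJ mulNmx bilN.
have qJ1 y : bil q J21^T y = - bil q R12 y.
  by rewrite /q !bil_mull QJ bilN.
have eR : bil x1 (Q11^T *m R11 *m Q11) x1 = bil q R11 q.
  by rewrite /q bil_mull bil_mulr.
have eP : bil x1 (Q11^T *m hatP) u = bil q hatP u by rewrite /q bil_mull.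
have ePT : bil u (hatP^T *m Q11) x1 = bil q hatP u by rewrite -bil_mulr bil_tr.
have zR : bil z (Q^T *m block_mx R11 R12 R12^T R22 *m Q) z =
    bil q R11 q + 2 * bil q R12 w + bil w R22 w.
  by rewrite -mulmxA -bil_mull -bil_mulr Qz bil_block bil_tr; ring.
have zP : bil z (Q^T *m P) u = bil q P1 u + bil w P2 u.
  by rewrite -bil_mull Qz bil_col.
have zPT : bil u (P^T *m Q) z = bil q P1 u + bil w P2 u.
  by rewrite -bil_mulr bil_tr Qz bil_col.
rewrite !bil_block eR eP ePT zR zP zPT.
clearbody q w.
have wJ : bil w J22 w = 0.
  by have := bil_tr w J22 w; rewrite J22N bilN; lra.
have wR : bil w R22 w = - bil w L22 w.
  by rewrite /L22 bilD bilN wJ; lra.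
(* Insert the constraint for [L22 w]; the parts of [L21] from [J21] and [R12] contribute equally,
   whence the factor 2. *)
have wL : bil w L22 w = 2 * bil q R12 w - bil w Bm u.
  rewrite -[L22]mul1mx -bil_mulr hw bilDr !bilNr !bil_mulr !mul1mx.
  rewrite /L21 bilD bilN -(bil_tr w J21) qJ1 bil_tr; lra.
have qY : bil q Y u = - 2 * bil q (R12 *m Li^T *m Bp) u.
  rewrite /Y !mulmxBl bilD bilN -![_ *m Li^T *m Bp]mulmxA qJ; lra.
(* Write [w] as [Li (L22 w)] and insert the constraint; this links the port term to the corrections
   in [hatP] and [hatS]. *)
have wBp : bil w Bp u = - bil q Y u - bil u (Bm^T *m Li^T *m Bp) u.
  rewrite -[w](mulKmx L22U) hw bil_mull bilDl !bilNl !bil_mull !mulmxA.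
  by rewrite /L21 linearB /= trmxK.
have sE : bil u (Bp^T *m Li *m Bm) u = bil u (Bm^T *m Li^T *m Bp) u.
  by rewrite -bil_tr !trmx_mul trmxK mulmxA.
rewrite /hatP /hatS !bilD !bilN !bilZ !bilD sE.
move: wBp wL; rewrite /Bp /Bm !bilD !bilN wR.
rewrite -/Bp -/Bm; lra.
Qed.
(** The index data are transported by [U^-1 Z2] and [V^-1 T2], for which all products occurring in
    the index assumption keep their rank or vanish as before. *)
Lemma L22_Q22_unitmx (R : realType) (I : set R) (d a m : nat)
    (c : coeffs R (d + a) m) (U V : R -> 'M[R]_(d + a)) (b : block_coeffs R d a m) :
  index_assumption I c a d ->
  (forall t, I t -> U t \in unitmx) -> (forall t, I t -> V t \in unitmx) ->
  coeffs_eq_on I (transform I U V c) (assemble b) ->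
  (forall t, I t -> E11 b t \in unitmx) ->
  forall t, I t -> L22 b t \in unitmx /\ Q22 b t \in unitmx.
Proof.
move=> [_ [_ [Z2 [T2 [_ idx]]]]] hU hV hbl hE t It.
have [_ [ZE rZA ZAT rET]] := idx t It.
have Ut := hU t It; have Vt := hV t It.
have [[eE eQ] [[eJ [eR eK]] _]] := hbl t It.
rewrite /= in eE eQ eJ eR eK.
pose W := invmx (V t) *m deriv_on I V t.
(* The term of [K] with the derivative of [V] enters only through [E W], whose lower block row is
   zero; hence it does not affect the lower right block. *)
have AE : (U t)^T *m sysmx c t *m V t =
    sysmx (assemble b) t + block_mx (E11 b t) 0 0 0 *m W.
  rewrite /sysmx /= -eE -eQ -eJ -eR -eK -/W; move: W => W.
  rewrite [_ *m (_ + W)]mulmxDr opprD addrA subrK.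
  rewrite -mulmxBl -mulmxBr; move: (cJ c t - cR c t) => JR.
  by rewrite mulmxBr mulmxBl !mulmxA !mulmxK.
have UTt : (U t)^T \in unitmx by rewrite unitmx_tr.
have Z2E X : (invmx (U t) *m Z2 t)^T *m ((U t)^T *m X) = (Z2 t)^T *m X.
  by rewrite trmx_mul trmx_inv mulmxA mulmxKV.
have : drsubmx ((U t)^T *m sysmx c t *m V t) \in unitmx.
  apply: (@index_drsubmx_unit _ _ _ (E11 b t) (invmx (U t) *m Z2 t)
    (invmx (V t) *m T2 t)).
  - exact: hE.
  - by rewrite -eE -!mulmxA Z2E mulmxA ZE mul0mx.
  - by rewrite -!mulmxA Z2E mulmxA mxrankMfree // row_free_unit.
  - by rewrite -!mulmxA Z2E mulKVmx // mulmxA.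
  - rewrite -eE -!mulmxA mulKVmx // -[RHS]rET -[LHS]mxrank_tr trmx_mul trmxK.
    by rewrite mxrankMfree ?mxrank_tr // row_free_unit.
have -> : drsubmx ((U t)^T *m sysmx c t *m V t) = L22 b t *m Q22 b t.
  rewrite AE /sysmx /= opp_block_mx add_block_mx !mulmx_block.
  rewrite -[W]submxK mulmx_block opp_block_mx !add_block_mx block_mxKdr.
  by rewrite !mul0mx !mulmx0 !addr0 add0r oppr0 addr0.
by rewrite unitmx_mul => /andP.
Qed.

(** * The reduced system: solvability and pHDAE properties *)

Section reduced_system.
Context {R : realType} (t0 tf : R) {d a m : nat}.
Hypothesis t0tf : t0 < tf.
Local Notation I := (`[t0, tf]%classic : set R).
Variable b : block_coeffs R d a m.
Hypothesis regb : regular_coeffs I (assemble b).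
Hypothesis strb : hamiltonian_structure I (assemble b).
Hypothesis E11U : forall t, I t -> E11 b t \in unitmx.
Hypothesis L22U : forall t, I t -> L22 b t \in unitmx.
Hypothesis Q22U : forall t, I t -> Q22 b t \in unitmx.
Hypothesis decoupled : forall t, I t ->
  (J12 b t - R12 b t) *m Q22 b t - E11 b t *m K12 b t = 0.

(** By decoupling [E11 K12 - J12 Q22 = - R12 Q22]; substituted into the off-diagonal structural
    identity, this leaves the invertible factor [Q22] to cancel. *)
Lemma Q11T_J21T t : I t -> (Q11 b t)^T *m (J21 b t)^T = - ((Q11 b t)^T *m R12 b t).
Proof.
move=> It; have [_ _ H _] := block_structureP t0tf regb strb It.
rewrite -[LHS](mulmxK (Q22U It)) -H.
have /eqP := decoupled It; rewrite subr_eq0 => /eqP <-.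
by rewrite mulmxBl addrAC subrr add0r mulmxN mulNmx mulmxA mulmxK ?Q22U.
Qed.

Lemma J22_skew t : I t -> (J22 b t)^T = - J22 b t.
Proof.
move=> It; have [_ _ _ H] := block_structureP t0tf regb strb It.
apply/eqP; rewrite -addr_eq0; apply/eqP.
have QT : (Q22 b t)^T \in unitmx by rewrite unitmx_tr Q22U.
rewrite -[LHS](mulKmx QT) -[_ *m (_ + _)](mulmxK (Q22U It)) H.
by rewrite mul0mx mulmx0.
Qed.

Definition constraint_solution t (x1 : 'cV[R]_d) (u : 'cV[R]_m) : 'cV[R]_a :=
  invmx (L22 b t *m Q22 b t)
    *m (- (L21 b t *m Q11 b t *m x1) - (B2 b t - P2 b t) *m u).

Lemma constraint_solutionP t u x1 v : I t ->
  algebraic_constraint b t u x1 v <-> v = constraint_solution t x1 u.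
Proof.
move=> It; have LQ : L22 b t *m Q22 b t \in unitmx.
  by rewrite unitmx_mul L22U ?Q22U.
by split=> [H|->]; [rewrite /constraint_solution -H mulKmx|
  rewrite /algebraic_constraint mulKVmx].
Qed.

Lemma C0_on_L21 : C0_on I (L21 b).
Proof.
have [_ cJ21 _] := C0_on_J regb; have [_ cR12 _] := C0_on_R regb.
exact: C0_onD cJ21 (C0_onN (C0_on_tr cR12)).
Qed.

Lemma C0_on_L22 : C0_on I (L22 b).
Proof.
have [_ _ cJ22] := C0_on_J regb; have [_ _ cR22] := C0_on_R regb.
exact: C0_onD cJ22 (C0_onN cR22).
Qed.

Lemma C0_on_constraint_solution (x1 : R -> 'cV[R]_d) (u : R -> 'cV[R]_m) :
  C0_on I x1 -> C0_on I u -> C0_on I (fun t => constraint_solution t (x1 t) (u t)).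
Proof.
move=> cx cu; have [_ cB2 _ cP2] := C0_on_BP regb.
have cQ11 := C1_on_C0_on (C1_on_Q11 t0tf regb).
apply: C0_onM.
  apply: C0_on_inv; first by move=> t It; rewrite unitmx_mul L22U ?Q22U.
  exact: C0_onM C0_on_L22 (C0_on_Q22 regb).
apply: C0_onD; apply: C0_onN.
  exact: C0_onM (C0_onM C0_on_L21 cQ11) cx.
exact: C0_onM (C0_onD cB2 (C0_onN cP2)) cu.
Qed.

Lemma block_solutionP u x1 x2 :
  block_solution I b u x1 x2 <->
  [/\ solution I (reduced b) u x1, C0_on I x2 &
      forall t, I t -> algebraic_constraint b t (u t) (x1 t) (x2 t)].
Proof.
split=> [[c1 c2 st]|[[c1 st] c2 alg]].
  split=> // [|t It]; last first.
    by have /(state_eq_assemble _ _ _ _ (decoupled It))[] := st t It.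
  by split=> // t It; have /(state_eq_assemble _ _ _ _ (decoupled It))[] := st t It.
split=> // t It; apply/(state_eq_assemble _ _ _ _ (decoupled It)).
by split; [exact: st|exact: alg].
Qed.

(** The lifted [x2] depends algebraically on [u] and so is in general no smoother than continuous,
    which is the regularity [block_solution] asks for. *)
Lemma block_solution_of_reduced u x1 : C0_on I u -> solution I (reduced b) u x1 ->
  block_solution I b u x1 (fun t => constraint_solution t (x1 t) (u t)).
Proof.
move=> cu sx; apply/block_solutionP.
split=> // [|t It]; last exact/constraint_solutionP.
by apply: C0_on_constraint_solution => //; exact: C1_on_C0_on sx.1.
Qed.

Let Mred t := invmx (E11 b t) *m sysmx (reduced b) t.
Let gred (u : R -> 'cV[R]_m) t := invmx (E11 b t) *m ((B1 b t - P1 b t) *m u t).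

Lemma C0_on_Mred : C0_on I Mred.
Proof.
have cE := C1_on_C0_on (C1_on_E11 t0tf regb).
have cQ := C1_on_C0_on (C1_on_Q11 t0tf regb).
have [cJ _ _] := C0_on_J regb; have [cR _ _] := C0_on_R regb.
apply: C0_onM; first exact: C0_on_inv.
apply: C0_onD; first exact: C0_onM (C0_onD cJ (C0_onN cR)) cQ.
exact: C0_onN (C0_onM cE (C0_on_K11 regb)).
Qed.

Lemma C0_on_gred u : C0_on I u -> C0_on I (gred u).
Proof.
have cE := C1_on_C0_on (C1_on_E11 t0tf regb).
have [cB _ cP _] := C0_on_BP regb.
move=> cu; apply: C0_onM; first exact: C0_on_inv.
exact: C0_onM (C0_onD cB (C0_onN cP)) cu.
Qed.

Lemma reduced_solutionP u x : C0_on I u ->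
  solution I (reduced b) u x <->
  forall t, I t -> has_mxder I x t (Mred t *m x t + gred u t).
Proof.
move=> cu; have hat t : hatB b t - hatP b t = B1 b t - P1 b t.
  by rewrite /hatB /hatP opprB addrA subrK.
have cD : C0_on I x -> C0_on I (fun t => Mred t *m x t + gred u t).
  by move=> cx; apply: C0_onD (C0_on_gred cu); exact: C0_onM C0_on_Mred cx.
have E t : I t -> state_eq (reduced b) t (u t) (x t) (deriv_on I x t) <->
    deriv_on I x t = Mred t *m x t + gred u t.
  move=> It; rewrite /state_eq /= hat /Mred /gred -mulmxA -mulmxDr.
  by split=> [<-|->]; rewrite ?mulKmx ?mulKVmx ?E11U.
split=> [[c1 st]|dx].
  apply/(C1_onP t0tf x (cD (C1_on_C0_on c1))); split=> // t It.
  by apply/E => //; exact: st.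
(* No circularity: differentiability makes [x] continuous, hence the right-hand side too, and this
   is the continuity of the derivative required by C1. *)
have cx := has_mxder_C0_on dx.
have [c1 xE] := (C1_onP t0tf x (cD cx)).2 dx.
by split=> // t It; apply/E => //; exact: xE.
Qed.

Lemma reduced_solution_exists u x10 : C0_on I u ->
  exists2 x1, solution I (reduced b) u x1 & x1 t0 = x10.
Proof.
move=> cu; have [x dx x0] := linear_ode_exists t0tf C0_on_Mred x10 (C0_on_gred cu).
by exists x => //; apply/reduced_solutionP.
Qed.

Lemma reduced_solution_unique u x y : C0_on I u ->
  solution I (reduced b) u x -> solution I (reduced b) u y ->
  x t0 = y t0 -> forall t, I t -> x t = y t.
Proof.
move=> cu /(reduced_solutionP _ cu) dx /(reduced_solutionP _ cu) dy.
exact: (linear_ode_unique (g := gred u) t0tf C0_on_Mred dx dy).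
Qed.

Lemma regular_coeffs_reduced : regular_coeffs I (reduced b).
Proof.
have [cB1 cB2 cP1 cP2] := C0_on_BP regb.
have [cJ11 cJ21 _] := C0_on_J regb; have [cR11 cR12 _] := C0_on_R regb.
have [_ [_ [_ [[cS cN] sym]]]] := regb.
have cBp := C0_onD cB2 cP2; have cBm := C0_onD cB2 (C0_onN cP2).
have cLi := C0_on_inv L22U C0_on_L22.
have cY := C0_onN (C0_onZ (c := 2^-1) (C0_onM (C0_onM
  (C0_onD (C0_on_tr cJ21) (C0_onN cR12)) (C0_on_tr cLi)) cBp)).
have cX1 := C0_onM (C0_onM (C0_on_tr cBp) cLi) cBm.
have cX2 := C0_onM (C0_onM (C0_on_tr cBm) (C0_on_tr cLi)) cBp.
split; first by split; [exact: C1_on_E11|exact: C1_on_Q11].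
split; first by split=> //; split=> //; exact: C0_on_K11.
split; first by split; [exact: C0_onD cB1 cY|exact: C0_onD cP1 cY].
split.
  split; first exact: C0_onD cS (C0_onN (C0_onZ (c := 2^-1) (C0_onD cX1 cX2))).
  exact: C0_onD cN (C0_onN (C0_onZ (c := 2^-1) (C0_onD cX1 (C0_onN cX2)))).
move=> t It; have [symS symN] := sym t It; rewrite /= in symS symN.
have tr12 (X Y : 'M[R]_(a, m)) (Z : 'M[R]_a) : (X^T *m Z *m Y)^T = Y^T *m Z^T *m X.
  by rewrite !trmx_mul trmxK mulmxA.
rewrite /= /hatS /hatN; split.
  rewrite linearB /= linearZ /= linearD /= !tr12 trmxK symS.
  by congr (_ - _ *: _); rewrite addrC.
rewrite linearB /= linearZ /= linearB /= !tr12 trmxK symN.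
move: ((_ + _)^T *m _ *m _) ((_ - _)^T *m _ *m _) => X1 X2.
by rewrite -[X2 - X1]opprB scalerN opprK opprB addrC.
Qed.

Lemma hamiltonian_structure_reduced : hamiltonian_structure I (reduced b).
Proof. by move=> t It; have [sym der _ _] := block_structureP t0tf regb strb It. Qed.

Lemma dissipation_reduced_psd t : I t ->
  symmetric_psd (dissipation_mx (assemble b) t) ->
  symmetric_psd (dissipation_mx (reduced b) t).
Proof.
move=> It [symW psdW].
have [_ [_ [_ [_ sym]]]] := regular_coeffs_reduced.
split.
  have := symW; rewrite [X in X = _ -> _]tr_block_mx => /eq_block_mx[symR _ _ _].
  move: symR; rewrite /= tr_block_mx !mulmx_block !trmx0 !mul0mx !mulmx0 !addr0.
  rewrite tr_block_mx => /eq_block_mx[symR _ _ _].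
  rewrite /dissipation_mx tr_block_mx /= symR.
  by rewrite !trmx_mul !trmxK (sym t It).1.
move=> v; rewrite -[v]vsubmxK; move: (usubmx v) (dsubmx v) => x1 u.
(* At fixed [t] any [x1] and [u] can be completed by an [x2] satisfying the constraint, so every
   test vector of the reduced form comes from one of the original form. *)
have alg := (constraint_solutionP u x1 _ It).2 erefl.
have := psdW (col_mx (col_mx x1 (constraint_solution t x1 u)) u).
have := reduced_dissipation (R11 b t) (P1 b t) (Sb b t) (J22_skew It)
  (Q11T_J21T It) (L22U It) alg.
by rewrite /bil => <-.
Qed.

End reduced_system.

Theorem theorem19 (R : realType) (t0 tf : R) (I : set R) (d a m : nat)
    (c : coeffs R (d + a) m) (U V : R -> 'M[R]_(d + a))
    (b : block_coeffs R d a m)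
    (ht : t0 < tf)
    (hI : I = `[t0, tf]%classic)
    (hpH : pHDAE I c)
    (hindex : index_assumption I c a d)
    (hU : forall t, I t -> U t \in unitmx)
    (hV : forall t, I t -> V t \in unitmx)
    (hVdiff : differentiable_on I V)
    (hblock : coeffs_eq_on I (transform I U V c) (assemble b))
    (hbpH : block_pHDAE I b)
    (hE11 : forall t, I t -> E11 b t \in unitmx)
    (hdecoupled : forall t, I t ->
       (J12 b t - R12 b t) *m Q22 b t - E11 b t *m K12 b t = 0) :
  (forall t, I t -> L22 b t \in unitmx /\ Q22 b t \in unitmx) /\
  (forall (u : R -> 'cV[R]_m) (x10 : 'cV[R]_d), C0_on I u ->
     (exists (x1 : R -> 'cV[R]_d) (x2 : R -> 'cV[R]_a),
        block_solution I b u x1 x2 /\ x1 t0 = x10 /\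
        forall (z1 : R -> 'cV[R]_d) (z2 : R -> 'cV[R]_a),
          block_solution I b u z1 z2 -> z1 t0 = x10 ->
          forall t, I t -> z1 t = x1 t /\ z2 t = x2 t) /\
     (forall (x1 : R -> 'cV[R]_d) (y : R -> 'cV[R]_m),
        (exists x2 : R -> 'cV[R]_a,
           block_solution I b u x1 x2 /\ x1 t0 = x10 /\
           forall t, I t ->
             y t = output (assemble b) t (u t) (col_mx (x1 t) (x2 t)))
        <->
        (solution I (reduced b) u x1 /\ x1 t0 = x10 /\
         forall t, I t -> y t = output (reduced b) t (u t) (x1 t))) /\
     (forall (x1 : R -> 'cV[R]_d) (x2 : R -> 'cV[R]_a),
        block_solution I b u x1 x2 -> x1 t0 = x10 ->
        forall t, I t -> forall v : 'cV[R]_a,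
          algebraic_constraint b t (u t) (x1 t) v <-> v = x2 t) /\
     (forall x20 : 'cV[R]_a,
        (exists (x1 : R -> 'cV[R]_d) (x2 : R -> 'cV[R]_a),
           block_solution I b u x1 x2 /\ x1 t0 = x10 /\ x2 t0 = x20) ->
        algebraic_constraint b t0 (u t0) x10 x20)) /\
  pHDAE I (reduced b) /\
  (forall t, I t -> forall (x1 : 'cV[R]_d) (x2 : 'cV[R]_a),
     hamiltonian (reduced b) t x1
       = hamiltonian (assemble b) t (col_mx x1 x2) /\
     hamiltonian (reduced b) t x1
       = hamiltonian c t (V t *m col_mx x1 x2)).
Proof.
subst I.
have units := L22_Q22_unitmx hindex hU hV hblock hE11.
have L22U t : `[t0, tf]%classic t -> L22 b t \in unitmx by move=> /units[].
have Q22U t : `[t0, tf]%classic t -> Q22 b t \in unitmx by move=> /units[].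
have [regb strb [h0 hlow] psdb] := hbpH.
have solP := block_solutionP hdecoupled.
have algP := @constraint_solutionP _ t0 tf _ _ _ b L22U Q22U.
have blk := block_solution_of_reduced ht regb L22U Q22U hdecoupled.
have It0 : `[t0, tf]%classic t0 by rewrite /= in_itv /= lexx ltW.
split; first exact: units.
split.
  move=> u x10 cu; split.
    have [x1 sx x10E] := reduced_solution_exists ht regb hE11 x10 cu.
    exists x1, (fun t => constraint_solution b t (x1 t) (u t)).
    split; first exact: blk.
    split=> // z1 z2 /solP[sz _ alg] z10 t It.
    have zx := reduced_solution_unique ht regb hE11 cu sz sx.
    have z1E : z1 t = x1 t by apply: zx => //; rewrite z10.
    by split=> //; have /algP := alg t It; rewrite -z1E; apply.
  split.
    move=> x1 y; split=> [[x2 [/solP[sx c2 alg] [x10E yE]]]|[sx [x10E yE]]].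
      split=> //; split=> // t It; rewrite yE //.
      by apply: output_reduced; [exact: L22U|exact: alg].
    exists (fun t => constraint_solution b t (x1 t) (u t)).
    split; first exact: blk.
    split=> // t It; rewrite yE //; apply/esym.
    by apply: output_reduced; [exact: L22U|apply/algP].
  split.
    move=> x1 x2 /solP[_ _ alg] _ t It v.
    have /algP := alg t It => /(_ It) ->; exact: algP.
  by move=> x20 [x1 [x2 [/solP[_ _ alg] [<- <-]]]]; exact: alg.
split.
  split.
  - exact: regular_coeffs_reduced.
  - by apply hamiltonian_structure_reduced.
  (* The bound of the block system serves again: a reduced solution lifts to a block solution with
     the same Hamiltonian values. *)
  - exists h0 => u x1 cu sx t It.
    rewrite (hamiltonian_reduced b t (x1 t) (constraint_solution b t (x1 t) (u t))).
    pose x2 s := constraint_solution b s (x1 s) (u s).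
    apply: (hlow u (fun s => col_mx (x1 s) (x2 s))) => //.
    rewrite (_ : (fun s => usubmx _) = x1); last first.
      by apply/funext => s; rewrite col_mxKu.
    rewrite (_ : (fun s => dsubmx _) = x2).
      exact: blk.
    by apply/funext => s; rewrite col_mxKd.
  - move=> t It.
    exact (dissipation_reduced_psd ht regb strb L22U Q22U hdecoupled It (psdb t It)).
move=> t It x1 x2; split; first exact: hamiltonian_reduced.
rewrite (hamiltonian_reduced b t x1 x2).
rewrite -(hamiltonian_transform `[t0, tf] c (U := U)); last exact: hU.
have [[eE eQ] _] := hblock t It.
by rewrite /hamiltonian eE eQ.
Qed.
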